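(* Let $(W_n)_n$ be a sequence of graphons $W_n:\Omega^2\to[0,1]$ converging to a graphon $W:\Omega^2\to[0,1]$ in the cut-distance, and let $F$ be an arbitrary finite graph. Then $\liminf_n\mathsf{til}(F,W_n)\ge\mathsf{til}(F,W)$.
   Context: $(\Omega,\nu)$ is an atomless Borel probability space; a graphon is a symmetric measurable $W:\Omega^2\to[0,1]$. The cut-norm is $\|V\|_\square=\sup_{A,B}|\int_{A\times B}V|$, and the cut-distance is $\delta_\square(U,W)=\inf_\varphi\|U-W^\varphi\|_\square$ over invertible measure-preserving $\varphi:\Omega\to\Omega$, $W^\varphi(x,y)=W(\varphi(x),\varphi(y))$. Let $F$ have vertex set $[k]$; $W^{\otimes F}(x_1,\dots,x_k)=\prod_{ij\in E(F),i<j}W(x_i,x_j)$, $\mathcal{F}_F(W)=\{W^{\otimes F}\neq0\}$. An $F$-tiling in $W$ is a measurable $\mathfrak{t}:\Omega^k\to[0,\infty)$ with $\{\mathfrak{t}\neq0\}\subset\mathcal{F}_F(W)$ such that for each $x\in\Omega$, $\sum_{\ell=1}^k\int\mathfrak{t}(x_1,\dots,x_{\ell-1},x,x_{\ell+1},\dots,x_k)\,\mathrm{d}\nu^{k-1}\le1$ (integrating over all coordinates except the $\ell$-th); its size is $\int\mathfrak{t}\,\mathrm{d}\nu^k$, and $\mathsf{til}(F,W)$ is the supremum of sizes of $F$-tilings in $W$. *)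

(* Defs.v *)
From HB Require Import structures.
From mathcomp Require Import all_boot all_order all_algebra.
From mathcomp Require Import all_classical all_reals all_analysis.
Set Implicit Arguments. Unset Strict Implicit. Unset Printing Implicit Defensive.
Import Order.TTheory GRing.Theory Num.Theory.
Import numFieldNormedType.Exports.
Local Open Scope classical_set_scope.
Local Open Scope ring_scope.

Section Graphons.
Context (R : realType) (d : measure_display) (T : measurableType d).

Definition std_borel : Prop :=
  exists f : T -> measurableTypeR R,
    [/\ injective f, measurable_fun setT f &
        forall A : set T, measurable A -> measurable (f @` A)].

Definition atomless (nu : {measure set T -> \bar R}) : Prop :=
  forall A : set T, measurable A -> (0 < nu A)%E ->
    exists2 B : set T, measurable B /\ B `<=` A & (0 < nu B < nu A)%E.

Definition graphon (W : T -> T -> R) : Prop :=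
  [/\ forall x y, W x y = W y x,
      forall x y, 0 <= W x y <= 1 &
      measurable_fun setT (fun z : T * T => W z.1 z.2)].

Variable nu : probability T R.

Definition cut_norm (V : T -> T -> R) : \bar R :=
  ereal_sup [set `| \int[nu \x nu]_(z in A `*` B) (V z.1 z.2)%:E |%E
            | A in [set A : set T | measurable A] & B in [set B : set T | measurable B]].


Definition mp_bij (phi : T -> T) : Prop :=
  exists psi : T -> T,
    [/\ cancel phi psi, cancel psi phi,
        measurable_fun setT phi /\ measurable_fun setT psi,
        forall A : set T, measurable A -> nu (phi @^-1` A) = nu A &
        forall A : set T, measurable A -> nu (psi @^-1` A) = nu A].

Definition cut_dist (U W : T -> T -> R) : \bar R :=
  ereal_inf [set cut_norm (fun x y => U x y - W (phi x) (phi y))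
            | phi in [set phi | mp_bij phi]].

Fixpoint iint (n : nat) (f : seq T -> \bar R) : \bar R :=
  match n with
  | 0 => f [::]
  | n'.+1 => (\int[nu]_x iint n' (fun s => f (x :: s)))%E
  end.

Definition tup_ext (k : nat) (g : k.-tuple T -> \bar R) (s : seq T) : \bar R :=
  if insub s is Some t then g t else 0%E.

Definition int_tuple (k : nat) (g : k.-tuple T -> \bar R) : \bar R :=
  iint k (tup_ext g).

Definition int_section (k : nat) (g : k.-tuple T -> \bar R) (l : 'I_k) (x : T)
  : \bar R :=
  iint k.-1 (fun s => tup_ext g (take l s ++ x :: drop l s)).

Definition simple_graph (k : nat) (E : rel 'I_k) : Prop :=
  symmetric E /\ irreflexive E.

Definition Wtensor (k : nat) (E : rel 'I_k) (W : T -> T -> R) (x : k.-tuple T) : R :=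
  \prod_(i < k) \prod_(j < k | (i < j)%N && E i j) W (tnth x i) (tnth x j).

Definition is_tiling (k : nat) (E : rel 'I_k) (W : T -> T -> R)
  (t : k.-tuple T -> R) : Prop :=
  [/\ measurable_fun setT t,
      forall x, 0 <= t x,
      forall x, t x != 0 -> Wtensor E W x != 0 &
      forall x : T, (\sum_(l < k) int_section (fun y => (t y)%:E) l x <= 1)%E].

Definition tiling_size (k : nat) (t : k.-tuple T -> R) : \bar R :=
  int_tuple (fun y => (t y)%:E).

Definition til (k : nat) (E : rel 'I_k) (W : T -> T -> R) : \bar R :=
  ereal_sup [set tiling_size t | t in [set t | is_tiling E W t]].

End Graphons.

(* Main.v *)
(** Let [t] be a tiling of [W].  Write [t = g * W^F] where [W^F] is the product of
    [W] over the edges of [F]; by monotone convergence [g] may be truncated, so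
    assume it is bounded.  If [U] is close to [W] in cut norm, replace [t] by
    [g * U^F].  The counting lemma (change one edge at a time), applied to
    rectangles, and then Dynkin's pi-lambda theorem give that the integral of
    [g * 1_A(x_l) * (U^F - W^F)] is small uniformly in the measurable set [A] and
    the coordinate [l].  With [A] everything this says that the size hardly
    changes; with [A = {h > 1}], where [h] is the sum of the sections of
    [g * U^F], it says that the excess [b = max(0, h - 1)] over the fractional
    constraint has small integral.  Multiplying by
    [max(0, 1 - sum_i b(x_i))] restores the constraint, because
    [(2 - h) h <= 1], at a small cost in size.  The relabellings in the cut
    distance are harmless since measure-preserving bijections transport tilings. *)
Require Import Defs.
From HB Require Import structures.
From mathcomp Require Import all_boot all_order all_algebra.
From mathcomp Require Import all_classical all_reals all_analysis.
From mathcomp Require Import measurable_realfun.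
From mathcomp Require Import ring lra.
Set Implicit Arguments. Unset Strict Implicit. Unset Printing Implicit Defensive.
Import Order.TTheory GRing.Theory Num.Theory.
Import numFieldNormedType.Exports.
Local Open Scope classical_set_scope.
Local Open Scope ring_scope.


(** * Bounded measurable functions on a probability space *)

Section BoundedMeasurable.
Context {R : realType}.

(** Bounded measurable functions form an algebra and are integrable for every probability, so
    real-valued integrals can be manipulated without separate integrability conditions. *)
Definition bmf d (T : measurableType d) (f : T -> R) : Prop :=
  measurable_fun setT f /\ exists C, forall x, `|f x| <= C.

Section Algebra.
Context {d} {T : measurableType d}.
Implicit Types f g : T -> R.

Lemma bmf_unit f : measurable_fun setT f -> (forall x, 0 <= f x <= 1) -> bmf f.
Proof.
move=> mf f01; split => //; exists 1 => x.
by have /andP[f0 f1] := f01 x; rewrite ger0_norm.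
Qed.

Lemma bmf_cst c : bmf (fun _ : T => c).
Proof. by split; [exact: measurable_cst | exists `|c|]. Qed.

Lemma bmf_indic A : measurable A -> bmf (\1_A : T -> R).
Proof.
move=> mA; apply: bmf_unit; first exact: measurable_indic.
by move=> x; rewrite indicE; case: (x \in A); rewrite /= ?lexx ?ler01.
Qed.

Lemma bmfD f g : bmf f -> bmf g -> bmf (fun x => f x + g x).
Proof.
move=> [mf [C Cf]] [mg [D Dg]]; split; first exact: measurable_funD.
by exists (C + D) => x; rewrite (le_trans (ler_normD _ _))// lerD.
Qed.

Lemma bmfB f g : bmf f -> bmf g -> bmf (fun x => f x - g x).
Proof.
move=> [mf [C Cf]] [mg [D Dg]]; split; first exact: measurable_funB.
by exists (C + D) => x; rewrite (le_trans (ler_normB _ _))// lerD.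
Qed.

Lemma bmfM f g : bmf f -> bmf g -> bmf (fun x => f x * g x).
Proof.
move=> [mf [C Cf]] [mg [D Dg]]; split; first exact: measurable_funM.
by exists (C * D) => x; rewrite normrM ler_pM.
Qed.

Lemma bmf_norm f : bmf f -> bmf (fun x => `|f x|).
Proof.
move=> [mf [C Cf]]; split; first exact: measurableT_comp.
by exists C => x; rewrite normr_id.
Qed.

Lemma bmf_max f g : bmf f -> bmf g -> bmf (fun x => Num.max (f x) (g x)).
Proof.
move=> [mf [C Cf]] [mg [D Dg]]; split; first exact: measurable_maxr.
exists (C + D) => x; apply: le_trans (lerD (Cf x) (Dg x)).
by rewrite /Num.max; case: ifP => _; [rewrite lerDr | rewrite lerDl].
Qed.

Lemma bmf_sum (I : Type) (r : seq I) (F : I -> T -> R) :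
  (forall i, bmf (F i)) -> bmf (fun x => \sum_(i <- r) F i x).
Proof.
move=> bF; elim: r => [|i r IH].
  by under eq_fun do rewrite big_nil; exact: bmf_cst.
by under eq_fun do rewrite big_cons; exact: bmfD.
Qed.

Lemma bmf_prod (I : Type) (r : seq I) (F : I -> T -> R) :
  (forall i, bmf (F i)) -> bmf (fun x => \prod_(i <- r) F i x).
Proof.
move=> bF; elim: r => [|i r IH].
  by under eq_fun do rewrite big_nil; exact: bmf_cst.
by under eq_fun do rewrite big_cons; exact: bmfM.
Qed.

Lemma bmf_comp d' (T' : measurableType d') (phi : T' -> T) f :
  bmf f -> measurable_fun setT phi -> bmf (fun x => f (phi x)).
Proof.
by move=> [mf [C Cf]] mphi; split; [exact: measurableT_comp | exists C].
Qed.

Variable mu : probability T R.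

Lemma bmf_integrable f : bmf f -> mu.-integrable setT (EFin \o f).
Proof.
move=> [mf [C Cf]]; apply: measurable_bounded_integrable => //.
  by rewrite -ge0_fin_numE ?fin_num_measure.
exists C; split; first by rewrite num_real.
by move=> D CD x _; exact: (le_trans (Cf x) (ltW CD)).
Qed.

Lemma RintD f g : bmf f -> bmf g ->
  \int[mu]_x (f x + g x) = \int[mu]_x f x + \int[mu]_x g x.
Proof. by move=> bf bg; rewrite RintegralD//; exact: bmf_integrable. Qed.

Lemma RintB f g : bmf f -> bmf g ->
  \int[mu]_x (f x - g x) = \int[mu]_x f x - \int[mu]_x g x.
Proof. by move=> bf bg; rewrite RintegralB//; exact: bmf_integrable. Qed.

Lemma RintZ c f : bmf f -> \int[mu]_x (c * f x) = c * \int[mu]_x f x.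
Proof. by move=> bf; rewrite RintegralZl//; exact: bmf_integrable. Qed.

Lemma RintN f : bmf f -> \int[mu]_x (- f x) = - \int[mu]_x f x.
Proof.
move=> bf; rewrite -mulN1r -RintZ//; apply: eq_Rintegral => x _.
by rewrite mulN1r.
Qed.

Lemma Rint_cst c : \int[mu]_x c = c.
Proof. by rewrite Rintegral_cst// [X in fine X]probability_setT mulr1. Qed.

Lemma Rint_indic A : measurable A -> \int[mu]_x \1_A x = fine (mu A).
Proof. by move=> mA; rewrite /Rintegral integral_indic// setIT. Qed.

Lemma Rint_sum (I : Type) (r : seq I) (F : I -> T -> R) :
  (forall i, bmf (F i)) ->
  \int[mu]_x (\sum_(i <- r) F i x) = \sum_(i <- r) \int[mu]_x F i x.
Proof.
move=> bF; elim: r => [|i r IH].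
  under eq_Rintegral do rewrite big_nil.
  by rewrite Rint_cst big_nil.
under eq_Rintegral do rewrite big_cons.
by rewrite RintD ?IH ?big_cons//; exact: bmf_sum.
Qed.

Lemma le_Rint f g : bmf f -> bmf g -> (forall x, f x <= g x) ->
  \int[mu]_x f x <= \int[mu]_x g x.
Proof. by move=> bf bg fg; apply: le_Rintegral => //; exact: bmf_integrable. Qed.

Lemma le_norm_Rint f g : bmf f -> bmf g -> (forall x, `|f x| <= g x) ->
  `|\int[mu]_x f x| <= \int[mu]_x g x.
Proof.
move=> bf bg fg; apply: le_trans (le_normr_Rintegral measurableT _) _.
  exact: bmf_integrable.
by apply: le_Rint => //; exact: bmf_norm.
Qed.

Lemma norm_Rint_le f c : bmf f -> (forall x, `|f x| <= c) ->
  `|\int[mu]_x f x| <= c.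
Proof.
by move=> bf fc; rewrite -(Rint_cst c); apply: le_norm_Rint => //; exact: bmf_cst.
Qed.

Lemma EFin_Rint f : bmf f -> (\int[mu]_x (f x)%:E)%E = (\int[mu]_x f x)%:E.
Proof.
by move=> bf; rewrite /Rintegral fineK//; apply/integrable_fin_num => //; exact: bmf_integrable.
Qed.

End Algebra.

(** * Fubini for bounded functions *)

Section Product.
Context d1 d2 (T1 : measurableType d1) (T2 : measurableType d2).
Variables (m1 : probability T1 R) (m2 : probability T2 R) (f : T1 * T2 -> R).
Hypothesis bf : bmf f.

Lemma bmf_section1 x : bmf (fun y => f (x, y)).
Proof. by apply: bmf_comp => //; exact: measurable_pair1. Qed.

Lemma bmf_section2 y : bmf (fun x => f (x, y)).
Proof. by apply: bmf_comp => //; exact: measurable_pair2. Qed.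

Lemma bmf_Rint_section1 : bmf (fun x => \int[m2]_y f (x, y)).
Proof.
have bfi := @bmf_integrable _ _ (m1 \x m2)%E f bf.
split.
  apply/measurable_EFinP.
  rewrite [X in measurable_fun _ X](_ : _ = fubini_F m2 (EFin \o f)).
    exact: measurable_fubini_F bfi.
  by apply/funext => x; rewrite /= -EFin_Rint//; exact: bmf_section1.
have [mf [C Cf]] := bf; exists C => x.
by apply: norm_Rint_le => //; exact: bmf_section1.
Qed.

Lemma bmf_Rint_section2 : bmf (fun y => \int[m1]_x f (x, y)).
Proof.
have bfi := @bmf_integrable _ _ (m1 \x m2)%E f bf.
split.
  apply/measurable_EFinP.
  rewrite [X in measurable_fun _ X](_ : _ = fubini_G m1 (EFin \o f)).
    exact: measurable_fubini_G bfi.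
  by apply/funext => x; rewrite /= -EFin_Rint//; exact: bmf_section2.
have [mf [C Cf]] := bf; exists C => x.
by apply: norm_Rint_le => //; exact: bmf_section2.
Qed.

Lemma Rint_prod1 :
  \int[(m1 \x m2)%E]_z f z = \int[m1]_x \int[m2]_y f (x, y).
Proof.
have bfi := @bmf_integrable _ _ (m1 \x m2)%E f bf.
rewrite {1}/Rintegral -[X in fine X](integral12_prod_meas1 bfi).
congr fine; apply: eq_integral => x _.
by rewrite -EFin_Rint//; exact: bmf_section1.
Qed.

Lemma Rint_prod2 :
  \int[(m1 \x m2)%E]_z f z = \int[m2]_y \int[m1]_x f (x, y).
Proof.
have bfi := @bmf_integrable _ _ (m1 \x m2)%E f bf.
rewrite {1}/Rintegral -[X in fine X](integral21_prod_meas1 bfi).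
congr fine; apply: eq_integral => x _.
by rewrite -EFin_Rint//; exact: bmf_section2.
Qed.

End Product.
End BoundedMeasurable.

(** * Images of probability measures *)

Section ImageProbability.
Context {R : realType} d1 d2 (T1 : measurableType d1) (T2 : measurableType d2).
Variables (P : probability T1 R) (f : T1 -> T2).
Hypothesis mf : measurable_fun setT f.

Let image := pushforward P f.

Let image0 : image set0 = 0%E. Proof. exact: measure0. Qed.

Let image_ge0 A : (0 <= image A)%E. Proof. exact: measure_ge0. Qed.

Let image_sigma_additive : semi_sigma_additive image.
Proof. exact: measure_semi_sigma_additive. Qed.

HB.instance Definition _ := isMeasure.Build _ _ _ image
  image0 image_ge0 image_sigma_additive.

Let image_setT : image setT = 1%E.
Proof. by rewrite /image /pushforward preimage_setT probability_setT. Qed.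

HB.instance Definition _ := Measure_isProbability.Build _ _ _ image image_setT.

Definition image_prob : probability T2 R := image.

Lemma image_probE A : image_prob A = P (f @^-1` A). Proof. by []. Qed.

End ImageProbability.

(** * Product measures on tuples *)

Section TupleSpace.
Context {d} {T : measurableType d}.

Definition rect n (A : 'I_n -> set T) : set (n.-tuple T) :=
  [set t | forall i, A i (tnth t i)].

Definition rects n : set (set (n.-tuple T)) :=
  [set rect A | A in [set A : 'I_n -> set T | forall i, measurable (A i)]].

Lemma measurable_rect n (A : 'I_n -> set T) :
  (forall i, measurable (A i)) -> measurable (rect A).
Proof.
move=> mA.
have -> : rect A = \big[setI/setT]_(i < n) ((fun t => tnth t i) @^-1` A i).
  apply/seteqP; split => t.
    by move=> At; rewrite -bigcap_seq => i _; exact: At.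
  by rewrite -bigcap_seq => At i; apply: At; rewrite /= mem_index_enum.
apply: bigsetI_measurable => i _; rewrite -[X in measurable X]setTI.
exact: measurable_tnth.
Qed.

(** The generating cylinders of the tuple sigma-algebra are rectangles with all sides but one equal
    to [setT]; conversely a rectangle is a finite intersection of cylinders. *)
Lemma measurable_rectsE n : measurable = <<s @rects n >>.
Proof.
apply/seteqP; split.
  apply: smallest_sub; first exact: smallest_sigma_algebra.
  move=> X; rewrite -bigcup_seq => -[i _ [A mA <-]].
  apply: sub_sigma_algebra.
  exists (fun j => if j == i then A else setT).
    by move=> j /=; case: ifP.
  rewrite setTI; apply/seteqP; split => t /=.
    by move=> /(_ i); rewrite eqxx.
  by move=> Ai j; case: eqP => // ->.
apply: smallest_sub; first exact: sigma_algebra_measurable.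
by move=> _ [A mA <-]; exact: measurable_rect.
Qed.

Lemma rects_setI n : setI_closed (@rects n).
Proof.
move=> _ _ [A mA <-] [B mB <-].
exists (fun i => A i `&` B i); first by move=> i; exact: measurableI.
apply/seteqP; split => t /=; first by move=> H; split=> i; have [] := H i.
by move=> [H1 H2] i; split; [exact: H1|exact: H2].
Qed.

Lemma rects_setT n : rects (n := n) setT.
Proof.
by exists (fun=> setT) => //; apply/seteqP; split.
Qed.

(** Defined through [unlift] so that coordinates are computed by cases on [unliftP]; [val_tins]
    links it to the [take]/[drop] form used in [int_section]. *)
Definition tins n (l : 'I_n.+1) (x : T) (s : n.-tuple T) : n.+1.-tuple T :=
  [tuple if unlift l i is Some j then tnth s j else x | i < n.+1].

Lemma tnth_tins n (l : 'I_n.+1) x (s : n.-tuple T) : tnth (tins l x s) l = x.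
Proof. by rewrite tnth_mktuple unlift_none. Qed.

Lemma tnth_tins_lift n (l : 'I_n.+1) x (s : n.-tuple T) j :
  tnth (tins l x s) (lift l j) = tnth s j.
Proof. by rewrite tnth_mktuple liftK. Qed.

Lemma val_tins n (l : 'I_n.+1) x (s : n.-tuple T) :
  val (tins l x s) = take l s ++ x :: drop l s.
Proof.
have ln : (l <= n)%N by rewrite -ltnS.
have sz : size (take l s) = l by rewrite size_takel ?size_tuple.
apply: (@eq_from_nth _ x).
  by rewrite size_tuple size_cat /= size_drop sz size_tuple addnS subnKC.
move=> i; rewrite size_tuple => ilt.
rewrite (_ : i = Ordinal ilt) // -tnth_nth.
case: (unliftP l (Ordinal ilt)) => [j ->|->]; last first.
  by rewrite tnth_tins nth_cat sz ltnn subnn.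
rewrite tnth_tins_lift nth_cat sz /= /bump.
case: (leqP l j) => lj.
  rewrite add1n ltnNge leqW //= subSn // /=.
  by rewrite nth_drop subnKC // (tnth_nth x).
by rewrite add0n lj nth_take // (tnth_nth x).
Qed.

Lemma measurable_tins n (l : 'I_n.+1) :
  measurable_fun setT (fun z : T * n.-tuple T => tins l z.1 z.2).
Proof.
apply/measurable_fun_tnthP => i.
case: (unliftP l i) => [j|] ->.
  rewrite (_ : _ \o _ = (fun s => tnth s j) \o snd); last first.
    by apply/funext => z /=; rewrite tnth_tins_lift.
  by apply: measurableT_comp => //; exact: measurable_tnth.
rewrite (_ : _ \o _ = fst)//.
by apply/funext => z /=; rewrite tnth_tins.
Qed.

Lemma preimage_tins_rect n (l : 'I_n.+1) (A : 'I_n.+1 -> set T) :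
  (fun z : T * n.-tuple T => tins l z.1 z.2) @^-1` rect A =
  A l `*` rect (fun j => A (lift l j)).
Proof.
apply/seteqP; split => -[x s] /=.
  move=> H; split; first by have := H l; rewrite tnth_tins.
  by move=> j; have := H (lift l j); rewrite tnth_tins_lift.
move=> [Ax As] i; case: (unliftP l i) => [j|] ->.
  by rewrite tnth_tins_lift; exact: As.
by rewrite tnth_tins.
Qed.

Context {R : realType}.
Variable nu : probability T R.

(** The product measure, built one front coordinate at a time like [iint], so that the two integrals
    can be compared by induction. *)
Fixpoint tpow n : probability (n.-tuple T) R :=
  match n with
  | 0 => \d_([tuple] : 0.-tuple T)
  | n'.+1 => image_prob (nu \x tpow n')%E (@measurable_tins n' ord0)
  end.

Lemma tpow_rect n (A : 'I_n -> set T) : (forall i, measurable (A i)) ->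
  tpow n (rect A) = (\prod_(i < n) fine (nu (A i)))%:E.
Proof.
elim: n A => [|n IH] A mA.
  by rewrite big_ord0 /= diracE mem_set//; move=> [].
rewrite [tpow _]/= image_probE preimage_tins_rect.
rewrite [LHS]product_measure1E//; last first.
  by apply: measurable_rect => j; exact: mA.
rewrite [X in (_ * X)%E]IH; last by move=> i; exact: mA.
rewrite big_ord_recl EFinM fineK ?fin_num_measure//.
Qed.

(** Rectangles form a generating pi-system that contains the whole space, so they determine a
    probability. *)
Lemma tpow_unique n (P : probability (n.-tuple T) R) :
  (forall A : 'I_n -> set T, (forall i, measurable (A i)) ->
    P (rect A) = (\prod_(i < n) fine (nu (A i)))%:E) ->
  forall X, measurable X -> P X = tpow n X.
Proof.
move=> PE; apply: (measure_unique (@rects n) (fun=> setT)).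
- exact: measurable_rectsE.
- exact: rects_setI.
- by move=> _; exact: rects_setT.
- by rewrite bigcup_const.
- by move=> _ [A mA <-]; rewrite [RHS]tpow_rect// [LHS]PE.
- by move=> _; rewrite [X in (X < _)%E]probability_setT ltry.
Qed.

Section Pushforward.
Context d' (Z : measurableType d') (P : probability Z R) (n : nat).
Variable Phi : Z -> n.-tuple T.
Hypothesis mPhi : measurable_fun setT Phi.
Hypothesis PhiE : forall A : 'I_n -> set T, (forall i, measurable (A i)) ->
  P (Phi @^-1` rect A) = (\prod_(i < n) fine (nu (A i)))%:E.

(** Change of variables along a map whose law is the product measure on rectangles. Inserting a
    coordinate, resampling two coordinates and applying a measure-preserving map to every coordinate
    are all instances. *)
Lemma ge0_integral_tpow (g : n.-tuple T -> \bar R) :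
  measurable_fun setT g -> (forall t, 0 <= g t)%E ->
  (\int[tpow n]_t g t = \int[P]_z g (Phi z))%E.
Proof.
move=> mg g0.
have /= <- := @ge0_integral_pushforward _ _ _ _ _ _ mPhi P setT g measurableT mg
  (fun y _ => g0 y).
apply: eq_measure_integral => A mA _.
exact/esym/(@tpow_unique n (image_prob P mPhi)).
Qed.

Lemma Rint_tpow (g : n.-tuple T -> R) : bmf g ->
  \int[tpow n]_t g t = \int[P]_z g (Phi z).
Proof.
move=> bg; have [/measurable_EFinP mg _] := bg.
rewrite /Rintegral.
have := @integral_pushforward _ _ _ _ _ _ mPhi P setT (EFin \o g) mg.
rewrite preimage_setT => /(_ (bmf_integrable P (bmf_comp bg mPhi)) measurableT).
move=> /= <-; congr fine.
apply: eq_measure_integral => A mA _.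
exact/esym/(@tpow_unique n (image_prob P mPhi)).
Qed.

End Pushforward.

Lemma tins_law n (l : 'I_n.+1) (A : 'I_n.+1 -> set T) :
  (forall i, measurable (A i)) ->
  (nu \x tpow n)%E ((fun z => tins l z.1 z.2) @^-1` rect A) =
  (\prod_(i < n.+1) fine (nu (A i)))%:E.
Proof.
move=> mA; rewrite preimage_tins_rect [LHS]product_measure1E//; last first.
  by apply: measurable_rect => j; exact: mA.
rewrite [X in (_ * X)%E]tpow_rect; last by move=> i; exact: mA.
by rewrite (bigD1_ord l)//= EFinM fineK ?fin_num_measure.
Qed.

Lemma Rint_tins n (l : 'I_n.+1) (g : n.+1.-tuple T -> R) : bmf g ->
  \int[tpow n.+1]_t g t = \int[nu]_x \int[tpow n]_s g (tins l x s).
Proof.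
move=> bg; rewrite (Rint_tpow (@measurable_tins n l) (@tins_law n l) bg).
rewrite (Rint_prod1 _ _ (f := fun z => g (tins l z.1 z.2)))//.
exact: bmf_comp (@measurable_tins n l).
Qed.

(** Tonelli, by induction: each step of [iint] peels off the coordinate inserted at [ord0]. *)
Lemma iintE n (f : seq T -> \bar R) :
  measurable_fun setT (fun t : n.-tuple T => f t) ->
  (forall t : n.-tuple T, 0 <= f t)%E ->
  iint nu n f = (\int[tpow n]_t f t)%E.
Proof.
elim: n f => [|n IH] f mf f0.
  by rewrite /= integral_dirac// diracT mul1e.
rewrite (ge0_integral_tpow (@measurable_tins n ord0) (@tins_law n ord0) mf f0).
have mg := measurableT_comp mf (@measurable_tins n ord0).
rewrite (fubini_tonelli1 _ mg); last by move=> z; exact: f0.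
rewrite /= /fubini_F; apply: eq_integral => x _.
have E (s : n.-tuple T) : x :: s = tins ord0 x s.
  by rewrite [RHS]val_tins take0 drop0.
rewrite IH.
- by apply: eq_integral => s _; rewrite E.
- rewrite (_ : (fun t : n.-tuple T => _) = fun s => f (tins ord0 x s)).
    exact: measurableT_comp mg (measurable_pair1 x).
  by apply/funext => s; rewrite E.
- by move=> s; rewrite E.
Qed.

Lemma tup_extE n (g : n.-tuple T -> \bar R) (t : n.-tuple T) :
  tup_ext g t = g t.
Proof. by rewrite /tup_ext valK. Qed.

Lemma int_tupleE n (g : n.-tuple T -> \bar R) :
  measurable_fun setT g -> (forall t, 0 <= g t)%E ->
  int_tuple nu g = (\int[tpow n]_t g t)%E.
Proof.
move=> mg g0; have E := tup_extE g.
rewrite /int_tuple iintE.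
- by apply: eq_integral => t _.
- by rewrite (funext E).
- by move=> t; rewrite E.
Qed.

Lemma int_sectionE n (g : n.+1.-tuple T -> \bar R) l x :
  measurable_fun setT g -> (forall t, 0 <= g t)%E ->
  int_section nu g l x = (\int[tpow n]_s g (tins l x s))%E.
Proof.
move=> mg g0.
have E (s : n.-tuple T) : tup_ext g (take l s ++ x :: drop l s) = g (tins l x s).
  by rewrite -val_tins tup_extE.
rewrite /int_section /= iintE.
- by apply: eq_integral => t _; rewrite E.
- rewrite (funext E).
  exact: measurableT_comp (measurableT_comp mg (@measurable_tins n l)) (measurable_pair1 x).
- by move=> t; rewrite E.
Qed.

End TupleSpace.

(** * The counting lemma *)

Section CutBound.
Context {R : realType} {d} {T : measurableType d}.
Variable nu : probability T R.

(** A cut-norm bound with the rectangle written as indicator weights, which can then be replaced by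
    arbitrary $[0,1]$-valued weights. *)
Definition cut_le (V : T * T -> R) (delta : R) : Prop :=
  forall A B : set T, measurable A -> measurable B ->
  `|\int[(nu \x nu)%E]_z (\1_A z.1 * \1_B z.2 * V z)| <= delta.

(* A linear functional on [0,1]-valued weights is extremal at an indicator. *)
Lemma weighted_le (c a : T -> R) (delta : R) : bmf c ->
  (forall A, measurable A -> \int[nu]_x (\1_A x * c x) <= delta) ->
  measurable_fun setT a -> (forall x, 0 <= a x <= 1) ->
  \int[nu]_x (a x * c x) <= delta.
Proof.
move=> bc cA ma a01.
have mp : measurable [set x | 0 < c x].
  rewrite -[X in measurable X]setTI.
  apply: (measurable_fun_ltr (f := fun=> 0)) => //; exact: bc.1.
apply: le_trans (cA _ mp); apply: le_Rint.
- by apply: bmfM => //; exact: bmf_unit.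
- by apply: bmfM => //; exact: bmf_indic.
move=> x; have /andP[a0 a1] := a01 x; rewrite indicE.
case: (ltP 0 (c x)) => cx.
  by rewrite mem_set// mul1r ler_piMl// ltW.
rewrite memNset ?mul0r; first by rewrite mulr_ge0_le0.
by apply/negP; rewrite -leNgt.
Qed.

Section Weights.
Variables (V : T * T -> R) (delta : R).
Hypothesis bV : bmf V.
Hypothesis cutV : cut_le V delta.
Variables a b : T -> R.
Hypothesis ma : measurable_fun setT a.
Hypothesis mb : measurable_fun setT b.
Hypothesis a01 : forall x, 0 <= a x <= 1.
Hypothesis b01 : forall x, 0 <= b x <= 1.

Let bmf_fst (f : T -> R) : bmf f -> bmf (fun z : T * T => f z.1).
Proof. by move=> bf; exact: bmf_comp. Qed.

Let bmf_snd (f : T -> R) : bmf f -> bmf (fun z : T * T => f z.2).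
Proof. by move=> bf; exact: bmf_comp. Qed.

Lemma Rint_weight_fst (f : T -> R) (W : T * T -> R) : bmf f -> bmf W ->
  \int[(nu \x nu)%E]_z (f z.1 * W z) =
  \int[nu]_x (f x * \int[nu]_y W (x, y)).
Proof.
move=> bf bW; rewrite Rint_prod1/=.
  by apply: eq_Rintegral => x _; rewrite RintZ//; exact: bmf_section1.
by apply: bmfM => //; exact: bmf_fst.
Qed.

Lemma Rint_weight_snd (f : T -> R) (W : T * T -> R) : bmf f -> bmf W ->
  \int[(nu \x nu)%E]_z (f z.2 * W z) =
  \int[nu]_y (f y * \int[nu]_x W (x, y)).
Proof.
move=> bf bW; rewrite Rint_prod2/=.
  by apply: eq_Rintegral => x _; rewrite RintZ//; exact: bmf_section2.
by apply: bmfM => //; exact: bmf_snd.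
Qed.

(** The integral is linear in each weight. With [b] fixed, [a] is replaced by an indicator; with
    that indicator fixed, [b] is replaced by another. *)
Lemma cut_weight_le : \int[(nu \x nu)%E]_z (a z.1 * b z.2 * V z) <= delta.
Proof.
have ba := bmf_unit ma a01; have bb := bmf_unit mb b01.
have bbV : bmf (fun z => b z.2 * V z) by apply: bmfM => //; exact: bmf_snd.
under eq_Rintegral do rewrite -mulrA.
rewrite Rint_weight_fst//; apply: weighted_le => //.
  exact: (bmf_Rint_section1 nu nu bbV).
move=> A mA.
have b1A := bmf_indic (R := R) mA.
have bAV : bmf (fun z => \1_A z.1 * V z) by apply: bmfM => //; exact: bmf_fst.
rewrite -[X in X <= _](Rint_weight_fst b1A bbV).
under eq_Rintegral do rewrite mulrCA.
rewrite Rint_weight_snd//; apply: weighted_le => //.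
  exact: (bmf_Rint_section2 nu nu bAV).
move=> B mB.
rewrite -[X in X <= _](Rint_weight_snd (bmf_indic mB) bAV).
under eq_Rintegral do rewrite mulrA (mulrC (\1_B _)).
exact: le_trans (ler_norm _) (cutV mA mB).
Qed.

End Weights.

(** The one-sided bound is applied to [V] and to [- V]. *)
Lemma cut_weight_norm_le (V : T * T -> R) (delta : R) (a b : T -> R) :
  bmf V -> cut_le V delta ->
  measurable_fun setT a -> measurable_fun setT b ->
  (forall x, 0 <= a x <= 1) -> (forall x, 0 <= b x <= 1) ->
  `|\int[(nu \x nu)%E]_z (a z.1 * b z.2 * V z)| <= delta.
Proof.
move=> bV cutV ma mb a01 b01.
have mul1B (f g : T -> R) : bmf f -> bmf g -> bmf (fun z : T * T => f z.1 * g z.2 * V z).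
  by move=> bf bg; apply: bmfM => //; apply: bmfM; exact: bmf_comp.
have NV (f g : T -> R) : bmf f -> bmf g ->
    \int[(nu \x nu)%E]_z (f z.1 * g z.2 * - V z) =
    - \int[(nu \x nu)%E]_z (f z.1 * g z.2 * V z).
  move=> bf bg; rewrite -RintN; last exact: mul1B.
  by apply: eq_Rintegral => z _; rewrite mulrN.
rewrite ler_norml cut_weight_le// andbT lerNl -NV; try exact: bmf_unit.
apply: cut_weight_le => //.
  rewrite (_ : (fun z => - V z) = fun z => 0 - V z).
    by apply: bmfB => //; exact: bmf_cst.
  by apply/funext => z; rewrite sub0r.
move=> A B mA mB; rewrite NV ?normrN; first exact: cutV.
- exact: bmf_indic.
- exact: bmf_indic.
Qed.

End CutBound.

(** * Resampling the ends of an edge, and exchanging edges one at a time *)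

Section Resampling.
Context {R : realType} {d} {T : measurableType d}.
Variable nu : probability T R.
Variable k : nat.
Implicit Types (s t : k.-tuple T) (i j l : 'I_k).

Definition upd i j y z s : k.-tuple T :=
  [tuple if l == i then y else if l == j then z else tnth s l | l < k].

Lemma tnth_upd1 i j y z s : tnth (upd i j y z s) i = y.
Proof. by rewrite tnth_mktuple eqxx. Qed.

Lemma tnth_upd2 i j y z s : i != j -> tnth (upd i j y z s) j = z.
Proof. by move=> ij; rewrite tnth_mktuple eqxx eq_sym (negbTE ij). Qed.

Lemma tnth_upd i j y z s l : l != i -> l != j ->
  tnth (upd i j y z s) l = tnth s l.
Proof. by move=> li lj; rewrite tnth_mktuple (negbTE li) (negbTE lj). Qed.

Lemma measurable_upd i j :
  measurable_fun setT
    (fun w : k.-tuple T * (T * T) => upd i j w.2.1 w.2.2 w.1).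
Proof.
apply/measurable_fun_tnthP => l.
have [->|li] := eqVneq l i.
  rewrite (_ : _ \o _ = fst \o snd); first exact: measurableT_comp.
  by apply/funext => w /=; rewrite tnth_upd1.
have [lj|lj] := eqVneq l j.
  rewrite (_ : _ \o _ = snd \o snd); first exact: measurableT_comp.
  by apply/funext => w /=; rewrite lj tnth_upd2// -lj eq_sym.
rewrite (_ : _ \o _ = (fun s => tnth s l) \o fst).
  by apply: measurableT_comp => //; exact: measurable_tnth.
by apply/funext => w /=; rewrite tnth_upd.
Qed.

(* Resampling two coordinates preserves the product measure; this isolates the
   factor of a single edge under the integral. *)
Lemma upd_law i j (A : 'I_k -> set T) : i != j ->
  (forall l, measurable (A l)) ->
  (tpow nu k \x (nu \x nu))%E
    ((fun w : k.-tuple T * (T * T) => upd i j w.2.1 w.2.2 w.1) @^-1` rect A) =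
  (\prod_(l < k) fine (nu (A l)))%:E.
Proof.
move=> ij mA.
(* Coordinates [i] and [j] of the old tuple are overwritten, so they are unconstrained. *)
pose B l := if (l == i) || (l == j) then setT else A l.
have mB l : measurable (B l) by rewrite /B; case: ifP.
rewrite [X in (_ \x _)%E X](_ : _ = rect B `*` (A i `*` A j)); last first.
  apply/seteqP; split => -[s [y z]] /=.
    move=> H; split; last first.
      split; first by have := H i; rewrite tnth_upd1.
      by have := H j; rewrite tnth_upd2.
    move=> l; rewrite /B; case: ifPn => //; rewrite negb_or => /andP[li lj].
    by have := H l; rewrite tnth_upd.
  move=> [H [Ay Az]] l.
  have [->|li] := eqVneq l i; first by rewrite tnth_upd1.
  have [->|lj] := eqVneq l j; first by rewrite tnth_upd2.
  by rewrite tnth_upd//; have := H l; rewrite /B (negbTE li) (negbTE lj).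
have mAA : measurable (A i `*` A j) by exact: measurableX.
have nn : (nu \x nu)%E (A i `*` A j) = (nu (A i) * nu (A j))%E.
  exact: product_measure1E.
rewrite [LHS](product_measure1E (tpow nu k) (nu \x nu : probability _ _)%E
  (measurable_rect mB) mAA).
rewrite [X in (_ * X)%E]nn [X in (X * _)%E]tpow_rect//.
rewrite -[X in (_ * (X * _))%E]fineK ?fin_num_measure//.
rewrite -[X in (_ * (_ * X))%E]fineK ?fin_num_measure// -!EFinM.
congr (_%:E).
have ji : j != i by rewrite eq_sym.
rewrite (bigD1 i)//= (bigD1 j)//= [RHS](bigD1 i)//= [in RHS](bigD1 j)//=.
rewrite {1 2}/B !eqxx orbT [X in fine X]probability_setT !mul1r.
rewrite mulrC -mulrA; congr (_ * (_ * _)).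
by apply: eq_bigr => l /andP[li lj]; rewrite /B (negbTE li) (negbTE lj).
Qed.

Lemma Rint_upd i j (g : k.-tuple T -> R) : i != j -> bmf g ->
  \int[tpow nu k]_t g t =
  \int[tpow nu k]_s \int[(nu \x nu)%E]_z g (upd i j z.1 z.2 s).
Proof.
move=> ij bg.
rewrite (Rint_tpow (@measurable_upd i j) (fun A mA => upd_law ij mA) bg).
rewrite (Rint_prod1 _ _ (f := fun w => g (upd i j w.2.1 w.2.2 w.1)))//.
exact: bmf_comp (@measurable_upd i j).
Qed.

(* With all other coordinates frozen, [H] splits into a [0,1]-valued factor of
   coordinate [i] and one of coordinate [j]: the shape the cut norm controls. *)
Definition sep i j (H : k.-tuple T -> R) : Prop :=
  forall s, exists a b : T -> R,
  [/\ measurable_fun setT a, measurable_fun setT b,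
      forall x, 0 <= a x <= 1, forall x, 0 <= b x <= 1 &
      forall y z, H (upd i j y z s) = a y * b z].

Lemma sepM i j H1 H2 : sep i j H1 -> sep i j H2 ->
  sep i j (fun t => H1 t * H2 t).
Proof.
move=> h1 h2 s.
have [a1 [b1 [ma1 mb1 a1P b1P E1]]] := h1 s.
have [a2 [b2 [ma2 mb2 a2P b2P E2]]] := h2 s.
have P01 (f g : T -> R) : (forall x, 0 <= f x <= 1) -> (forall x, 0 <= g x <= 1) ->
    forall x, 0 <= f x * g x <= 1.
  move=> fP gP x; have /andP[f0 f1] := fP x; have /andP[g0 g1] := gP x.
  by rewrite mulr_ge0//= mulr_ile1.
exists (fun x => a1 x * a2 x), (fun x => b1 x * b2 x); split.
- exact: measurable_funM.
- exact: measurable_funM.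
- exact: P01.
- exact: P01.
- by move=> y z; rewrite E1 E2 mulrACA.
Qed.

Lemma sep_cst i j : sep i j (fun=> 1).
Proof.
move=> s; exists (fun=> 1), (fun=> 1); split => //.
- by move=> x; apply/andP; split.
- by move=> x; apply/andP; split.
- by move=> y z; rewrite mulr1.
Qed.

Lemma sep_prod i j (I : eqType) (r : seq I) (F : I -> k.-tuple T -> R) :
  (forall x, x \in r -> sep i j (F x)) ->
  sep i j (fun t => \prod_(x <- r) F x t).
Proof.
elim: r => [|x r IH] sF.
  have -> : (fun t => \prod_(x <- [::]) F x t) = fun=> 1.
    by apply/funext => t; rewrite big_nil.
  exact: sep_cst.
have -> : (fun t => \prod_(y <- x :: r) F y t) =
    fun t => F x t * \prod_(y <- r) F y t.
  by apply/funext => t; rewrite big_cons.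
apply: sepM; first exact: sF (mem_head _ _).
by apply: IH => y yr; apply: sF; rewrite inE yr orbT.
Qed.

Lemma sep_coord i j l (f : T -> R) : i != j -> measurable_fun setT f ->
  (forall x, 0 <= f x <= 1) -> sep i j (fun t => f (tnth t l)).
Proof.
move=> ij mf f01 s.
have one : 0 <= (1 : R) <= 1 by apply/andP; split.
have [->|li] := eqVneq l i.
  exists f, (fun=> 1); split => // y z.
  by rewrite tnth_upd1 mulr1.
have [->|lj] := eqVneq l j.
  exists (fun=> 1), f; split => // y z.
  by rewrite tnth_upd2// mul1r.
exists (fun=> f (tnth s l)), (fun=> 1); split => // y z.
by rewrite tnth_upd// mulr1.
Qed.

(** A different edge meets $\{i,j\}$ in at most one vertex, so with the other coordinates frozen its
    factor depends on at most one of the two variables. *)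
Lemma sep_edge i j (p q : 'I_k) (W : T -> T -> R) : (i < j)%N -> (p < q)%N ->
  (p, q) != (i, j) -> graphon W ->
  sep i j (fun t => W (tnth t p) (tnth t q)).
Proof.
move=> ij pq pqij [_ W01 mW] s.
have iNj : i != j by rewrite -val_eqE /= ltn_eqF.
have jNi : j != i by rewrite eq_sym.
have pNq : p != q by rewrite -val_eqE /= ltn_eqF.
have one : 0 <= (1 : R) <= 1 by apply/andP; split.
have m1 x : measurable_fun setT (fun y => W y x).
  exact: measurableT_comp mW (measurable_pair2 x).
have m2 x : measurable_fun setT (fun y => W x y).
  exact: measurableT_comp mW (measurable_pair1 x).
have [pi|pi] := eqVneq p i.
  have qi : q != i by rewrite -pi eq_sym.
  have qj : q != j by move: pqij; rewrite pi xpair_eqE eqxx.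
  exists (fun y => W y (tnth s q)), (fun=> 1); split => // y z.
  by rewrite pi tnth_upd1 tnth_upd// mulr1.
have [pj|pj] := eqVneq p j.
  have qj : q != j by rewrite -pj eq_sym.
  (* The ordering of the pairs excludes the reversed edge: here $q>p=j>i$. *)
  have qi : q != i.
    by rewrite -val_eqE /= gtn_eqF// (ltn_trans ij)// -pj.
  exists (fun=> 1), (fun y => W y (tnth s q)); split => // y z.
  by rewrite pj tnth_upd2// tnth_upd// mul1r.
have [qi|qi] := eqVneq q i.
  exists (fun y => W (tnth s p) y), (fun=> 1); split => // y z.
  by rewrite qi tnth_upd1 tnth_upd// mulr1.
have [qj|qj] := eqVneq q j.
  exists (fun=> 1), (fun y => W (tnth s p) y); split => // y z.
  by rewrite qj tnth_upd2// tnth_upd// mul1r.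
exists (fun=> W (tnth s p) (tnth s q)), (fun=> 1); split => // y z.
by rewrite !tnth_upd// mulr1.
Qed.

Lemma bmf_tnth l (f : T -> R) : bmf f -> bmf (fun t : k.-tuple T => f (tnth t l)).
Proof. by move=> bf; apply: bmf_comp => //; exact: measurable_tnth. Qed.

Lemma bmf_graphon (W : T -> T -> R) : graphon W -> bmf (fun z => W z.1 z.2).
Proof. by move=> [_ W01 mW]; apply: bmf_unit. Qed.

Lemma bmf_edge (p q : 'I_k) (W : T -> T -> R) : graphon W ->
  bmf (fun t : k.-tuple T => W (tnth t p) (tnth t q)).
Proof.
move=> /bmf_graphon bW.
have mpq : measurable_fun setT (fun t : k.-tuple T => (tnth t p, tnth t q)).
  by apply: measurable_fun_pair; exact: measurable_tnth.
exact: (bmf_comp bW mpq).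
Qed.

Variables (U W : T -> T -> R) (delta : R).
Hypothesis gU : graphon U.
Hypothesis gW : graphon W.
Hypothesis cutUW : cut_le nu (fun z => U z.1 z.2 - W z.1 z.2) delta.

(** After resampling coordinates [i] and [j], the inner integral for each frozen tuple is $\int
    a(y)b(z)(U-W)(y,z)$, which the cut norm bounds. *)
Lemma one_edge_le i j H : i != j -> bmf H -> sep i j H ->
  `|\int[tpow nu k]_t (H t * (U (tnth t i) (tnth t j) - W (tnth t i) (tnth t j)))|
  <= delta.
Proof.
move=> ij bH sH.
have bD : bmf (fun t : k.-tuple T => H t * (U (tnth t i) (tnth t j) - W (tnth t i) (tnth t j))).
  by apply: bmfM => //; apply: bmfB; exact: bmf_edge.
rewrite (Rint_upd ij bD); apply: norm_Rint_le.
  apply: (bmf_Rint_section1 (tpow nu k) _ (f := fun w => H (upd i j w.2.1 w.2.2 w.1) *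
   (U (tnth (upd i j w.2.1 w.2.2 w.1) i) (tnth (upd i j w.2.1 w.2.2 w.1) j) -
    W (tnth (upd i j w.2.1 w.2.2 w.1) i) (tnth (upd i j w.2.1 w.2.2 w.1) j)))).

  exact: bmf_comp bD (@measurable_upd i j).
move=> s; have [a [b [ma mb a01 b01 E]]] := sH s.
under eq_Rintegral do rewrite E tnth_upd1 tnth_upd2//.
by apply: cut_weight_norm_le => //; apply: bmfB; exact: bmf_graphon.
Qed.

Definition edge_prod (L : seq ('I_k * 'I_k)) (V : T -> T -> R) t : R :=
  \prod_(p <- L) V (tnth t p.1) (tnth t p.2).

Lemma bmf_edge_prod L V : graphon V -> bmf (edge_prod L V).
Proof. by move=> gV; apply: bmf_prod => p; exact: bmf_edge. Qed.

(** Edges are exchanged one by one, each costing [delta]. As [L] has no repetition, the other edge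
    factors stay separable for the edge being exchanged. *)
Lemma counting_le (L : seq ('I_k * 'I_k)) H : uniq L ->
  (forall p, p \in L -> (p.1 < p.2)%N) -> bmf H ->
  (forall p, p \in L -> sep p.1 p.2 H) ->
  `|\int[tpow nu k]_t (H t * (edge_prod L U t - edge_prod L W t))|
  <= (size L)%:R * delta.
Proof.
elim: L H => [|[i j] L IH] H /=.
  move=> _ _ _ _; rewrite mul0r (eq_Rintegral _ (g := fun=> 0)).
    by rewrite Rint_cst normr0.
  by move=> t _; rewrite /edge_prod !big_nil subrr mulr0.
move=> /andP[ijL uL] ltL bH sH.
have ij : (i < j)%N by exact: (ltL (i, j) (mem_head _ _)).
have iNj : i != j by rewrite -val_eqE /= ltn_eqF.
have ltL' p : p \in L -> (p.1 < p.2)%N.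
  by move=> pL; apply: ltL; rewrite inE pL orbT.
have bU := bmf_edge_prod L gU; have bW := bmf_edge_prod L gW.
have bUe := bmf_edge i j gU; have bWe := bmf_edge i j gW.
pose H1 t := H t * edge_prod L U t.
pose H2 t := H t * W (tnth t i) (tnth t j).
have bH1 : bmf H1 by exact: bmfM.
have bH2 : bmf H2 by exact: bmfM.
(* Telescoping: $u\,U^L-w\,W^L=U^L(u-w)+w(U^L-W^L)$, where $u,w$ are the factors of the first edge.
   The first term is a single exchange, the second is left to induction with weight [H2]. *)
rewrite (eq_Rintegral _ (g := fun t => H1 t * (U (tnth t i) (tnth t j) - W (tnth t i) (tnth t j))
   + H2 t * (edge_prod L U t - edge_prod L W t))); last first.
  by move=> t _; rewrite /H1 /H2 /edge_prod !big_cons /=; ring.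
rewrite RintD; [|by apply: bmfM => //; exact: bmfB..].
rewrite -natr1 mulrDl mul1r addrC; apply: le_trans (ler_normD _ _) _.
apply: lerD.
  apply: IH => // p pL; apply: sepM; first by apply: sH; rewrite inE pL orbT.
  apply: sep_edge => //; first exact: ltL'.
  by apply: contraNneq ijL => ->; rewrite -surjective_pairing.
apply: one_edge_le => //; apply: sepM; first exact: (sH (i, j) (mem_head _ _)).
apply: sep_prod => p pL; apply: sep_edge => //; first exact: ltL'.
by apply: contraNneq ijL => <-; rewrite -surjective_pairing.
Qed.

End Resampling.

(** * From rectangles to arbitrary bounded weights *)

Section Tame.
Context {R : realType} {d} {T : measurableType d}.
Variables (nu : probability T R) (k : nat) (E : rel 'I_k).

Definition edges : seq ('I_k * 'I_k) :=
  [seq p : 'I_k * 'I_k <- index_enum ('I_k * 'I_k)%type | (p.1 < p.2)%N && E p.1 p.2].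

Lemma WtensorE (V : T -> T -> R) : Wtensor E V = edge_prod edges V.
Proof.
apply/funext => t; rewrite /Wtensor pair_big_dep /edge_prod /edges big_filter.
by apply: eq_bigl => p.
Qed.

Lemma bmf_Wtensor (V : T -> T -> R) : graphon V -> bmf (Wtensor E V).
Proof. by move=> gV; rewrite WtensorE; exact: bmf_edge_prod. Qed.

Lemma Wtensor01 (V : T -> T -> R) t : graphon V -> 0 <= Wtensor E V t <= 1.
Proof.
move=> [_ V01 _]; rewrite WtensorE /edge_prod; apply/andP; split.
  by apply: prodr_ge0 => p _; have /andP[] := V01 (tnth t p.1) (tnth t p.2).
by apply: prodr_ile1 => p _; exact: V01.
Qed.

Variable W : T -> T -> R.
Hypothesis gW : graphon W.

(** The indicator at coordinate [l] allows the vertex constraint to be tested on a set of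
    vertices. *)
Definition discrepancy (U : T -> T -> R) (l : 'I_k) (A : set T) (t : k.-tuple T) : R :=
  \1_A (tnth t l) * (Wtensor E U t - Wtensor E W t).

Lemma bmf_discrepancy U l A : graphon U -> measurable A -> bmf (discrepancy U l A).
Proof.
move=> gU mA; apply: bmfM; first by apply: bmf_tnth; exact: bmf_indic.
by apply: bmfB; exact: bmf_Wtensor.
Qed.

Lemma discrepancy_le1 U l A t : graphon U -> `|discrepancy U l A t| <= 1.
Proof.
move=> gU; rewrite normrM mulr_ile1 ?normr_ge0//.
  by rewrite indicE ger0_norm; case: (_ \in _).
have /andP[u0 u1] := Wtensor01 t gU; have /andP[w0 w1] := Wtensor01 t gW.
by rewrite ler_norml; apply/andP; split; lra.
Qed.

(* [delta] must not depend on [A]: it is applied to a set that depends on [U]. *)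
Definition tame (g : k.-tuple T -> R) : Prop :=
  forall eps : R, 0 < eps -> exists2 delta : R, 0 < delta &
  forall U : T -> T -> R, graphon U -> cut_le nu (fun z => U z.1 z.2 - W z.1 z.2) delta ->
  forall l A, measurable A -> `|\int[tpow nu k]_t (g t * discrepancy U l A t)| <= eps.

Lemma tameD f g : bmf f -> bmf g -> tame f -> tame g ->
  tame (fun t => f t + g t).
Proof.
move=> bf bg tf tg eps e0.
have e20 : 0 < eps / 2 by rewrite divr_gt0.
have [df df0 Hf] := tf _ e20; have [dg dg0 Hg] := tg _ e20.
exists (Num.min df dg); first by rewrite lt_min df0.
move=> U gU cU l A mA; have bt := bmf_discrepancy l gU mA.
under eq_Rintegral do rewrite mulrDl.
rewrite RintD; [|exact: bmfM..].
rewrite (splitr eps); apply: le_trans (ler_normD _ _) _; apply: lerD.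
  apply: Hf => // B C mB mC; apply: le_trans (cU B C mB mC) _.
  by rewrite ge_min lexx.
apply: Hg => // B C mB mC; apply: le_trans (cU B C mB mC) _.
by rewrite ge_min lexx orbT.
Qed.

Lemma tameZ c f : bmf f -> tame f -> tame (fun t => c * f t).
Proof.
move=> bf tf eps e0.
have c0 : 0 < `|c| + 1 by rewrite ltr_wpDl.
have [df df0 Hf] := tf _ (divr_gt0 e0 c0).
exists df => // U gU cU l A mA; have bt := bmf_discrepancy l gU mA.
under eq_Rintegral do rewrite -mulrA.
rewrite RintZ; last exact: bmfM.
rewrite normrM; apply: le_trans (ler_wpM2l (normr_ge0 c) (Hf U gU cU l A mA)) _.
by rewrite mulrCA ger_pMr// ler_pdivrMr// mul1r lerDl.
Qed.

Lemma tame0 : tame (fun=> 0).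
Proof.
move=> eps e0; exists 1 => // U gU cU l A mA.
under eq_Rintegral do rewrite mul0r.
by rewrite Rint_cst normr0 ltW.
Qed.

Lemma tame_sum (I : Type) (r : seq I) (F : I -> k.-tuple T -> R) :
  (forall i, bmf (F i)) -> (forall i, tame (F i)) ->
  tame (fun t => \sum_(i <- r) F i t).
Proof.
move=> bF tF; elim: r => [|i r IH].
  have -> : (fun t => \sum_(i <- [::]) F i t) = fun=> 0.
    by apply/funext => t; rewrite big_nil.
  exact: tame0.
have -> : (fun t => \sum_(j <- i :: r) F j t) =
    fun t => F i t + \sum_(j <- r) F j t.
  by apply/funext => t; rewrite big_cons.
by apply: tameD => //; exact: bmf_sum.
Qed.

(** Tameness is closed under $L^1$ limits because a discrepancy is at most 1 in absolute value,
    uniformly in [U], [l] and [A]. *)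
Lemma tame_lim g : bmf g ->
  (forall eps : R, 0 < eps -> exists f, [/\ bmf f, tame f &
    \int[tpow nu k]_t `|g t - f t| <= eps]) ->
  tame g.
Proof.
move=> bg H eps e0.
have e20 : 0 < eps / 2 by rewrite divr_gt0.
have [f [bf tf gf]] := H _ e20.
have [df df0 Hf] := tf _ e20.
exists df => // U gU cU l A mA; have bt := bmf_discrepancy l gU mA.
have bgf : bmf (fun t => g t - f t) by exact: bmfB.
rewrite (eq_Rintegral _ (g := fun t => (g t - f t) * discrepancy U l A t +
  f t * discrepancy U l A t)); last by move=> t _; ring.
rewrite RintD; [|exact: bmfM..].
rewrite (splitr eps); apply: le_trans (ler_normD _ _) _; apply: lerD; last exact: Hf.
apply: le_trans gf; apply: le_norm_Rint.
- exact: bmfM.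
- exact: bmf_norm.
by move=> t; rewrite normrM ler_piMr// discrepancy_le1.
Qed.

(** The indicator of a rectangle, even multiplied by that of [A] at coordinate [l], is a product of
    one-coordinate factors. It is therefore separable for every edge, and the counting lemma
    applies. *)
Lemma tame_rect (A0 : 'I_k -> set T) : (forall i, measurable (A0 i)) ->
  tame \1_(rect A0).
Proof.
move=> mA0 eps e0.
have s0 : 0 < (size edges)%:R + 1 :> R by rewrite ltr_wpDl.
(* The added 1 keeps the denominator positive when there are no edges. *)
exists (eps / ((size edges)%:R + 1)); first exact: divr_gt0.
move=> U gU cU l A mA.
have rE t : \1_(rect A0) t = \prod_(i < k) \1_(A0 i) (tnth t i) :> R.
  rewrite indicE; case: (boolP (t \in _)) => [/set_mem tA|tA].
    by rewrite big1// => i _; rewrite indicE mem_set//; exact: tA.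
  have [i Ai] : exists i, ~ A0 i (tnth t i).
    by apply/existsNP => H; move/negP: tA; apply; rewrite inE.
  by rewrite (bigD1 i)//= indicE memNset// mul0r.
have i01 (B : set T) x : 0 <= (\1_B x : R) <= 1.
  by rewrite indicE; case: (_ \in _); rewrite ?lexx ?ler01.
have lt12 p : p \in edges -> (p.1 < p.2)%N.
  by rewrite mem_filter => /andP[/andP[]].
rewrite (eq_Rintegral _ (g := fun t => (\prod_(i < k) \1_(A0 i) (tnth t i) * \1_A (tnth t l)) *
  (edge_prod edges U t - edge_prod edges W t))); last first.
  by move=> t _; rewrite rE /discrepancy !WtensorE mulrA.
apply: le_trans (counting_le gU gW cU _ lt12 _ _) _.
- by rewrite filter_uniq// index_enum_uniq.
- apply: bmfM; last by apply: bmf_tnth; exact: bmf_indic.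
  by apply: bmf_prod => i; apply: bmf_tnth; exact: bmf_indic.
- move=> p pE.
  have ij : p.1 != p.2 by rewrite -val_eqE /= ltn_eqF// lt12.
  apply: sepM; last by apply: sep_coord => //; exact: measurable_indic.
  by apply: sep_prod => i _; apply: sep_coord => //; exact: measurable_indic.
by rewrite mulrCA ger_pMr// ler_pdivrMr// mul1r lerDl.
Qed.

(** By sigma-additivity the finite partial unions approximate the disjoint union in $L^1$, and their
    indicators are finite sums of tame ones. *)
Lemma tame_bigcup (F : (set (k.-tuple T))^nat) :
  (forall n, measurable (F n)) -> trivIset setT F ->
  (forall n, tame \1_(F n)) -> tame \1_(\bigcup_n F n).
Proof.
move=> mF tF tameF.
have mU : measurable (\bigcup_n F n) by exact: bigcupT_measurable.
have sumE N t : \sum_(i < N) \1_(F i) t = \1_(\big[setU/set0]_(i < N) F i) t :> R.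
  elim: N => [|N IH]; first by rewrite !big_ord0 indic0.
  rewrite !big_ord_recr IH /= !indicE in_setU.
  case: (boolP (t \in F N)) => [/set_mem tFN|_]; last by rewrite orbF addr0.
  rewrite orbT memNset ?add0r// -bigcup_mkord => -[i /= iN tFi].
  have /trivIsetP/(_ i N I I) := tF.
  by rewrite ltn_eqF// => /(_ isT)/seteqP[/(_ t)] + _; apply.
apply: tame_lim; first exact: bmf_indic.
move=> eps e0.
have := @measure_semi_sigma_additive _ _ _ (tpow nu k) F mF tF mU.
rewrite -[X in _ --> X]fineK ?fin_num_measure//.
move=> /fine_cvgP[_ /cvgrPdist_le/(_ _ e0)[N _ /(_ N (leqnn N))]] /= HN.
exists (fun t => \sum_(i < N) \1_(F i) t); split.
- by apply: bmf_sum => i; exact: bmf_indic.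
- by apply: tame_sum => // i; exact: bmf_indic.
apply: le_trans HN.
have bS : bmf (fun t => \sum_(i < N) \1_(F i) t : R).
  by apply: bmf_sum => i; exact: bmf_indic.
have bU : bmf (\1_(\bigcup_n F n) : k.-tuple T -> R) by exact: bmf_indic.
rewrite (eq_Rintegral _ (g := fun t => \1_(\bigcup_n F n) t - \sum_(i < N) \1_(F i) t)).
  rewrite RintB// Rint_indic// Rint_sum; last by move=> i; exact: bmf_indic.
  rewrite big_mkord -sum_fine; last by move=> i _; rewrite fin_num_measure.
  under eq_bigr do rewrite Rint_indic//.
  exact: ler_norm.
move=> t _; rewrite ger0_norm// subr_ge0 sumE !indicE.
case: (boolP (t \in \big[setU/set0]_(i < N) F i)) => [/set_mem|_]; last by case: (_ \in _).
rewrite -bigcup_mkord => -[i _ Fi]; rewrite mem_set//.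
by exists i.
Qed.

(** Dynkin's theorem: rectangles are a generating pi-system, and the sets with tame indicator are
    stable under complement and countable disjoint union. *)
Lemma tame_indic (S : set (k.-tuple T)) : measurable S -> tame \1_S.
Proof.
rewrite measurable_rectsE => mS.
apply: (dynkin_induction (P := fun S : set (k.-tuple T) => tame \1_S)
  (@measurable_rectsE _ T k) (@rects_setI _ T k) _ _ _ _ mS) => //.
- by have [A mA <-] := @rects_setT _ T k; exact: tame_rect.
- by move=> _ [A mA <-]; exact: tame_rect.
- move=> X mX tX.
  have -> : \1_(~` X) = (fun t => \1_setT t + (-1) * \1_X t) :> (k.-tuple T -> R).
    apply/funext => t; rewrite !indicE in_setC in_setT.
    by case: (t \in X) => /=; ring.
  apply: tameD.
  + exact: bmf_indic.
  + by apply: bmfM; [exact: bmf_cst|exact: bmf_indic].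
  + by have [A mA <-] := @rects_setT _ T k; exact: tame_rect.
  + by apply: tameZ => //; exact: bmf_indic.
- exact: tame_bigcup.
Qed.

(* The sum is the integer part of [y]: this writes a bounded function as a uniform
   limit of sums of indicators. *)
Lemma floor_sum_dist (m : nat) (y : R) : 0 <= y <= m%:R ->
  `|y - \sum_(j < m) ((j.+1%:R <= y)%R : bool)%:R| <= 1.
Proof.
elim: m => [|m IH] /andP[y0 ym].
  by rewrite big_ord0 subr0 ger0_norm// (le_trans ym).
rewrite big_ord_recr /=; have [ym1|ym1] := leP m.+1%:R y; last first.
  rewrite addr0; have [ym2|ym2] := leP y m%:R; first by apply: IH; rewrite y0.
  rewrite (eq_bigr (fun=> 1)).
    rewrite sumr_const card_ord ger0_norm ?subr_ge0 ?ltW//.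
    by move: ym1; rewrite -natr1; lra.
  by move=> j _; rewrite (le_trans _ (ltW ym2))// ler_nat.
have -> : y = m.+1%:R by apply/eqP; rewrite eq_le ym.
rewrite (eq_bigr (fun=> 1)).
  by rewrite sumr_const card_ord -natr1 subrr normr0.
by move=> j _; rewrite ler_nat ltnS ltnW.
Qed.

Lemma tame_bounded (g : k.-tuple T -> R) (M : R) : measurable_fun setT g ->
  (forall t, 0 <= g t <= M) -> tame g.
Proof.
move=> mg gM.
have bg : bmf g.
  by split => //; exists M => t; have /andP[g0 gM'] := gM t; rewrite ger0_norm.
apply: tame_lim => // eps e0.
have [m mM] : exists m : nat, M / eps <= m%:R.
  exists (Num.truncn `|M / eps|).+1; apply: le_trans (ler_norm _) _.
  exact/ltW/truncnS_gt.
(* Layers of height [eps]: their sum is [g] rounded down to a multiple of [eps], and [m] layers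
   exhaust the range of [g]. *)
pose F (j : 'I_m) t : R := eps * \1_[set t | j.+1%:R <= g t / eps] t.
have mF (j : 'I_m) : measurable [set t | j.+1%:R <= g t / eps].
  rewrite -[X in measurable X]setTI.
  apply: (measurable_fun_ler (f := fun=> j.+1%:R)) => //.
  exact: measurable_funM.
have bF j : bmf (F j).
  by apply: bmfM; [exact: bmf_cst|exact: bmf_indic].
exists (fun t => \sum_(j < m) F j t); split.
- exact: bmf_sum.
- apply: tame_sum => // j; apply: tameZ; first exact: bmf_indic.
  exact: tame_indic.
rewrite -[X in _ <= X](Rint_cst (tpow nu k)); apply: le_Rint.
- by apply: bmf_norm; apply: bmfB => //; exact: bmf_sum.
- exact: bmf_cst.
move=> t; rewrite /F -mulr_sumr.
have -> : g t = eps * (g t / eps) by rewrite mulrC divfK// gt_eqF.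
rewrite -mulrBr normrM gtr0_norm// ger_pMr//.
under eq_bigr => j _.
  rewrite indicE (_ : (t \in _) = (j.+1%:R <= g t / eps)); last first.
    by apply/idP/idP => [/set_mem //|?]; exact/mem_set.
  over.
apply: floor_sum_dist.
have /andP[g0 gM'] := gM t.
apply/andP; split; first by rewrite divr_ge0// ltW.
by apply: le_trans mM; rewrite ler_pM2r// invr_gt0.
Qed.

End Tame.

(** * Perturbing a tiling *)

Section SectionSum.
Context {R : realType} {d} {T : measurableType d}.
Variables (nu : probability T R) (n : nat).
Implicit Types f g : n.+1.-tuple T -> R.

(** For bounded nonnegative [f] this is the left side of the constraint in [is_tiling], as a real
    number. *)
Definition secsum f (x : T) : R :=
  \sum_(l < n.+1) \int[tpow nu n]_s f (tins l x s).

Lemma bmf_tins f l : bmf f -> bmf (fun z : T * n.-tuple T => f (tins l z.1 z.2)).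
Proof. by move=> bf; exact: bmf_comp bf (@measurable_tins _ _ n l). Qed.

Lemma bmf_tins1 f l x : bmf f -> bmf (fun s : n.-tuple T => f (tins l x s)).
Proof. by move=> bf; exact: bmf_section1 (bmf_tins l bf) x. Qed.

Lemma bmf_secsum f : bmf f -> bmf (secsum f).
Proof.
move=> bf; apply: bmf_sum => l.
exact: (bmf_Rint_section1 nu (tpow nu n) (bmf_tins l bf)).
Qed.

Lemma Rint_coord_weight f (phi : T -> R) l : bmf f -> bmf phi ->
  \int[tpow nu n.+1]_t (phi (tnth t l) * f t) =
  \int[nu]_x (phi x * \int[tpow nu n]_s f (tins l x s)).
Proof.
move=> bf bphi; rewrite (Rint_tins _ l); last by apply: bmfM => //; exact: bmf_tnth.
apply: eq_Rintegral => x _.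
rewrite -RintZ; last exact: bmf_tins1.
by apply: eq_Rintegral => s _; rewrite tnth_tins.
Qed.

Lemma Rint_coord (phi : T -> R) l : bmf phi ->
  \int[tpow nu n.+1]_t phi (tnth t l) = \int[nu]_x phi x.
Proof.
move=> bphi; rewrite (Rint_tins _ l); last exact: bmf_tnth.
apply: eq_Rintegral => x _; under eq_Rintegral do rewrite tnth_tins.
by rewrite Rint_cst.
Qed.

(** Turns a test of the pointwise constraint into integrals over tuples, which tameness controls. *)
Lemma Rint_secsum_weight f (phi : T -> R) : bmf f -> bmf phi ->
  \int[nu]_x (phi x * secsum f x) =
  \sum_(l < n.+1) \int[tpow nu n.+1]_t (phi (tnth t l) * f t).
Proof.
move=> bf bphi; rewrite /secsum; under eq_Rintegral do rewrite mulr_sumr.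
rewrite Rint_sum; last first.
  move=> l; apply: bmfM => //.
  exact: (bmf_Rint_section1 nu (tpow nu n) (bmf_tins l bf)).
by apply: eq_bigr => l _; rewrite Rint_coord_weight.
Qed.

Lemma tiling_sizeE f : bmf f -> (forall t, 0 <= f t) ->
  tiling_size nu f = (\int[tpow nu n.+1]_t f t)%:E.
Proof.
move=> bf f0; rewrite /tiling_size int_tupleE.
- by rewrite EFin_Rint.
- by apply/measurable_EFinP; exact: bf.1.
- by move=> t; rewrite lee_fin.
Qed.

Lemma sum_int_sectionE f x : bmf f -> (forall t, 0 <= f t) ->
  (\sum_(l < n.+1) int_section nu (fun y => (f y)%:E) l x)%E = (secsum f x)%:E.
Proof.
move=> bf f0; rewrite /secsum -sumEFin; apply: eq_bigr => l _.
rewrite int_sectionE.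
- by rewrite EFin_Rint//; exact: bmf_tins1.
- by apply/measurable_EFinP; exact: bf.1.
- by move=> t; rewrite lee_fin.
Qed.

End SectionSum.

(** * Replacing $W$ by a nearby graphon and restoring the constraint *)

Section Perturbation.
Context {R : realType} {d} {T : measurableType d}.
Variables (nu : probability T R) (n : nat) (E : rel 'I_n.+1).
Variable W : T -> T -> R.
Hypothesis gW : graphon W.
Variables (g : n.+1.-tuple T -> R) (M : R).
Hypothesis mg : measurable_fun setT g.
Hypothesis M0 : 0 <= M.
Hypothesis gM : forall t, 0 <= g t <= M.
Hypothesis secW : forall x, secsum nu (fun t => g t * Wtensor E W t) x <= 1.

Let bg : bmf g.
Proof.
by split => //; exists M => t; have /andP[g0 gM'] := gM t; rewrite ger0_norm.
Qed.

Section Construction.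
Variables (U : T -> T -> R) (eps : R).
Hypothesis gU : graphon U.
Hypothesis discU : forall l A, measurable A ->
  `|\int[tpow nu n.+1]_t (g t * discrepancy E W U l A t)| <= eps.

Let fU t := g t * Wtensor E U t.
Let fW t := g t * Wtensor E W t.
Let h := secsum nu fU.
Let b x := Num.max 0 (h x - 1).
Let c (t : n.+1.-tuple T) := Num.max 0 (1 - \sum_(i < n.+1) b (tnth t i)).

Let bfU : bmf fU. Proof. by apply: bmfM => //; exact: bmf_Wtensor. Qed.
Let bfW : bmf fW. Proof. by apply: bmfM => //; exact: bmf_Wtensor. Qed.
Let bh : bmf h. Proof. exact: bmf_secsum. Qed.
Let bb : bmf b.
Proof. by apply: bmf_max; [exact: bmf_cst|apply: bmfB => //; exact: bmf_cst]. Qed.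
Let bc : bmf c.
Proof.
apply: bmf_max; first exact: bmf_cst.
apply: bmfB; first exact: bmf_cst.
by apply: bmf_sum => i; exact: bmf_tnth.
Qed.

Let b_ge0 x : 0 <= b x. Proof. by rewrite /b le_max lexx. Qed.
Let c_ge0 t : 0 <= c t. Proof. by rewrite /c le_max lexx. Qed.
Let fU_ge0 t : 0 <= fU t.
Proof.
by have /andP[g0 _] := gM t; have /andP[u0 _] := Wtensor01 E t gU; exact: mulr_ge0.
Qed.
Let fU_leM t : fU t <= M.
Proof.
have /andP[g0 g1] := gM t; have /andP[u0 u1] := Wtensor01 E t gU.
by apply: le_trans g1; rewrite /fU ler_piMr.
Qed.

Definition adjusted_tiling t : R := fU t * c t.

Lemma bmf_adjusted_tiling : bmf adjusted_tiling. Proof. exact: bmfM. Qed.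
Let bT := bmf_adjusted_tiling.
Let T_ge0 t : 0 <= adjusted_tiling t. Proof. exact: mulr_ge0. Qed.

(** On [B], where [h] exceeds 1, the excess is $h-1$. Replacing [U] by [W] in $\int_B h$ costs at
    most [eps] per coordinate, and the section sum for [W] is at most 1, so what remains is at most
    $\nu(B)$, which cancels. *)
Let excess_le : \int[nu]_x b x <= n.+1%:R * eps.
Proof.
pose B := [set x | 1 < h x].
have mB : measurable B.
  rewrite -[X in measurable X]setTI.
  by apply: (measurable_fun_ltr (f := fun=> 1)) => //; exact: bh.1.
have b1B : bmf (\1_B : T -> R) by exact: bmf_indic.
rewrite (eq_Rintegral _ (g := fun x => \1_B x * h x - \1_B x)); last first.
  move=> x _; rewrite /b indicE; have [hx|hx] := ltP 1 (h x).
    by rewrite mem_set// !mul1r; apply: max_r; rewrite subr_ge0 ltW.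
  rewrite memNset; last by move=> /=; apply/negP; rewrite -leNgt.
  by rewrite mul0r subr0; apply: max_l; rewrite subr_le0.
rewrite RintB//; last exact: bmfM.
rewrite Rint_secsum_weight//.
have -> : \sum_(l < n.+1) \int[tpow nu n.+1]_t (\1_B (tnth t l) * fU t) =
    \sum_(l < n.+1) \int[tpow nu n.+1]_t (\1_B (tnth t l) * fW t) +
    \sum_(l < n.+1) \int[tpow nu n.+1]_t (g t * discrepancy E W U l B t).
  rewrite -big_split /=; apply: eq_bigr => l _.
  rewrite -RintD; last 2 first.
  - by apply: bmfM => //; exact: bmf_tnth.
  - by apply: bmfM => //; exact: bmf_discrepancy.
  by apply: eq_Rintegral => t _; rewrite /fU /fW /discrepancy; ring.
rewrite -Rint_secsum_weight//.
have h1 : \int[nu]_x (\1_B x * secsum nu fW x) <= \int[nu]_x \1_B x.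
  apply: le_Rint => //; first by apply: bmfM => //; exact: bmf_secsum.
  by move=> x; rewrite ler_piMr// indicE; case: (_ \in _).
have h2 : \sum_(l < n.+1) \int[tpow nu n.+1]_t (g t * discrepancy E W U l B t) <= n.+1%:R * eps.
  rewrite mulr_natl -[X in _ *+ X](card_ord n.+1) -sumr_const; apply: ler_sum => l _.
  exact: le_trans (ler_norm _) (discU l mB).
lra.
Qed.

(** Passing from [W] to [U] costs [eps]. The factor [c] costs at most [M] times the integral of the
    summed excess, which has [n.+1] terms of integral at most [n.+1%:R * eps] each. *)
Lemma adjusted_tiling_size :
  \int[tpow nu n.+1]_t fW t - eps * (1 + M * n.+1%:R ^+ 2) <=
  \int[tpow nu n.+1]_t adjusted_tiling t.
Proof.
have h1 : \int[tpow nu n.+1]_t fW t - eps <= \int[tpow nu n.+1]_t fU t.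
  have := discU ord0 measurableT; rewrite ler_norml => /andP[+ _].
  rewrite (eq_Rintegral _ (g := fun t => fU t - fW t)); last first.
    by move=> t _; rewrite /discrepancy /fU /fW indicT /=; ring.
  rewrite RintB//; lra.
have h2 : \int[tpow nu n.+1]_t fU t - M * (n.+1%:R * \int[nu]_x b x) <=
    \int[tpow nu n.+1]_t adjusted_tiling t.
  have bs : bmf (fun t : n.+1.-tuple T => \sum_(i < n.+1) b (tnth t i)).
    by apply: bmf_sum => i; exact: bmf_tnth.
  have <- : \int[tpow nu n.+1]_t (\sum_(i < n.+1) b (tnth t i)) = n.+1%:R * \int[nu]_x b x.
    rewrite Rint_sum; last by move=> i; exact: bmf_tnth.
    under eq_bigr do rewrite Rint_coord//.
    by rewrite sumr_const card_ord mulr_natl.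
  rewrite -RintZ// -RintB//; last by apply: bmfM => //; exact: bmf_cst.
  apply: le_Rint => //.
    by apply: bmfB => //; apply: bmfM => //; exact: bmf_cst.
  move=> t; set S := \sum_(i < n.+1) _.
  have S0 : 0 <= S by apply: sumr_ge0.
  have cS : 1 - S <= c t by rewrite /c le_max lexx orbT.
  rewrite /adjusted_tiling; apply: (@le_trans _ _ (fU t * (1 - S))); last exact: ler_wpM2l.
  by rewrite mulrBr mulr1 lerD2l lerN2 ler_wpM2r.
have h3 : M * (n.+1%:R * \int[nu]_x b x) <= M * (n.+1%:R * (n.+1%:R * eps)).
  by do 2 apply: ler_wpM2l => //.
have -> : eps * (1 + M * n.+1%:R ^+ 2) = eps + M * (n.+1%:R * (n.+1%:R * eps)) by ring.
lra.
Qed.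

Lemma adjusted_tiling_is_tiling : is_tiling nu E U adjusted_tiling.
Proof.
split.
- exact: bT.1.
- exact: T_ge0.
- move=> t; rewrite /adjusted_tiling /fU !mulf_eq0 !negb_or.
  by move=> /andP[/andP[]].
move=> x; rewrite sum_int_sectionE// lee_fin.
(* When [x] is a coordinate of the tuple, [b x] is one of the nonnegative terms subtracted in [c],
   so [c] is at most this factor, which leaves the section integral. *)
apply: (@le_trans _ _ (Num.max 0 (1 - b x) * h x)).
  rewrite /h /secsum mulr_sumr; apply: ler_sum => l _.
  rewrite -RintZ; last exact: bmf_tins1.
  apply: le_Rint.
  - exact: bmf_tins1.
  - by apply: bmfM; [exact: bmf_cst|exact: bmf_tins1].
  move=> s; rewrite /adjusted_tiling mulrC; apply: ler_wpM2r => //.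
  rewrite /c ge_max !le_max lexx /=; apply/orP; right.
  rewrite lerD2l lerN2 (bigD1 l)//= tnth_tins lerDl.
  exact: sumr_ge0.
rewrite /b; have [hx|hx] := leP (h x) 1.
  rewrite (max_l (_ : h x - 1 <= 0)) ?subr_le0// subr0 max_r//.
  by rewrite mul1r.
rewrite (max_r (_ : 0 <= h x - 1)) ?subr_ge0 ?(ltW hx)//.
have [h2|h2] := leP (1 - (h x - 1)) 0.
  by rewrite mul0r.
(* Here $(2-h)h=1-(h-1)^2$. *)
by have := sqr_ge0 (h x - 1); rewrite expr2; lra.
Qed.

End Construction.

Lemma bounded_density_tiling (eps : R) : 0 < eps -> exists2 delta : R, 0 < delta &
  forall U : T -> T -> R, graphon U ->
  cut_le nu (fun z => U z.1 z.2 - W z.1 z.2) delta ->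
  ((\int[tpow nu n.+1]_t (g t * Wtensor E W t) - eps)%:E <= til nu E U)%E.
Proof.
move=> e0.
have K0 : 0 < 1 + M * n.+1%:R ^+ 2 by rewrite ltr_wpDr// mulr_ge0.
(* The tolerance is divided by the constant of [adjusted_tiling_size], so that the total loss is
   [eps]. *)
have [delta d0 H] := tame_bounded nu E gW mg gM (divr_gt0 e0 K0).
exists delta => // U gU cU.
have discU l A := H U gU cU l A.
apply: le_trans (ereal_sup_ubound _); last first.
  exists (adjusted_tiling U) => //; exact: adjusted_tiling_is_tiling gU.
rewrite tiling_sizeE.
- rewrite lee_fin; apply: le_trans (adjusted_tiling_size gU discU).
  by rewrite lerD2l lerN2 divfK// gt_eqF.
- exact: bmf_adjusted_tiling.
- by have [_ T0 _ _] := adjusted_tiling_is_tiling gU.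
Qed.

End Perturbation.

(** * Transport along measure-preserving bijections *)

Section Transfer.
Context {R : realType} {d} {T : measurableType d}.
Variable nu : probability T R.

Section MapTuple.
Variable phi : T -> T.
Hypothesis mphi : measurable_fun setT phi.
Hypothesis phi_mp : forall A : set T, measurable A -> nu (phi @^-1` A) = nu A.

Let mpre A : measurable A -> measurable (phi @^-1` A).
Proof. by move=> mA; rewrite -[X in measurable X]setTI; exact: mphi. Qed.

Definition tmap n (t : n.-tuple T) : n.-tuple T := map_tuple phi t.

Lemma measurable_tmap n : measurable_fun setT (@tmap n).
Proof.
apply/measurable_fun_tnthP => i.
rewrite (_ : _ \o _ = phi \o (fun t => tnth t i)).
  by apply: measurableT_comp => //; exact: measurable_tnth.
by apply/funext => t /=; rewrite tnth_map.
Qed.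

Lemma tmap_law n (A : 'I_n -> set T) : (forall i, measurable (A i)) ->
  tpow nu n (@tmap n @^-1` rect A) = (\prod_(i < n) fine (nu (A i)))%:E.
Proof.
move=> mA.
have -> : @tmap n @^-1` rect A = rect (fun i => phi @^-1` A i).
  by apply/seteqP; split => t /= H i; have := H i; rewrite tnth_map.
rewrite tpow_rect; last by move=> i; exact: mpre.
by under eq_bigr do rewrite phi_mp//.
Qed.

Lemma integral_tmap n (g : n.-tuple T -> \bar R) :
  measurable_fun setT g -> (forall t, 0 <= g t)%E ->
  (\int[tpow nu n]_t g (tmap t) = \int[tpow nu n]_t g t)%E.
Proof.
by move=> mg g0; rewrite (ge0_integral_tpow (@measurable_tmap n) (@tmap_law n) mg g0).
Qed.

Lemma tmap_tins n (l : 'I_n.+1) x (s : n.-tuple T) :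
  tmap (tins l x s) = tins l (phi x) (tmap s).
Proof.
apply: eq_from_tnth => i; rewrite tnth_map; case: (unliftP l i) => [j|] ->.
  by rewrite !tnth_tins_lift tnth_map.
by rewrite !tnth_tins.
Qed.

(** The image of the product measure under [phi] in both coordinates agrees with it on measurable
    rectangles, hence everywhere. *)
Lemma Rint_prod_map (G : T * T -> R) : bmf G ->
  \int[(nu \x nu)%E]_z G z = \int[(nu \x nu)%E]_z G (phi z.1, phi z.2).
Proof.
move=> bG; have [/measurable_EFinP mG _] := bG.
have mPhi : measurable_fun setT (fun z : T * T => (phi z.1, phi z.2)).
  by apply: measurable_fun_pair; exact: measurableT_comp.
pose nn : probability (T * T)%type R := (nu \x nu)%E.
have := @integral_pushforward _ _ _ _ _ _ mPhi nn setT (EFin \o G) mG.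
rewrite preimage_setT => /(_ (bmf_integrable nn (bmf_comp bG mPhi)) measurableT).
rewrite /Rintegral => /= <-; congr fine.
have nnE X : measurable X -> (nu \x nu)%E X = image_prob nn mPhi X.
  apply: product_measure_unique => A B mA mB.
  transitivity (nn ((phi @^-1` A) `*` (phi @^-1` B))); first by [].
  rewrite [LHS]product_measure1E//; try exact: mpre.
  by congr (_ * _)%E; exact: phi_mp.
by apply: eq_measure_integral => X mX _; exact: nnE.
Qed.

End MapTuple.

Definition pull (psi : T -> T) (U : T -> T -> R) x y := U (psi x) (psi y).

Lemma graphon_pull psi U : measurable_fun setT psi -> graphon U ->
  graphon (pull psi U).
Proof.
move=> mpsi [sU U01 mU]; split; rewrite /pull => //.
have mP : measurable_fun setT (fun z : T * T => (psi z.1, psi z.2)).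
  by apply: measurable_fun_pair; exact: measurableT_comp.
exact: measurableT_comp mU mP.
Qed.

(** If [t] tiles [pull psi U], then [t] composed with [phi] tiles [U], since [pull psi U] at
    $(\varphi(x),\varphi(y))$ is $U(x,y)$. Its section at [x] is that of [t] at [phi x], and the
    sizes agree. *)
Lemma til_pull n (E : rel 'I_n.+1) (U : T -> T -> R) (phi psi : T -> T) :
  cancel phi psi -> measurable_fun setT phi ->
  (forall A : set T, measurable A -> nu (phi @^-1` A) = nu A) ->
  (til nu E (pull psi U) <= til nu E U)%E.
Proof.
move=> phiK mphi phi_mp; apply: ub_ereal_sup => _ [t [mt t0 tU tsec] <-].
have mtE : measurable_fun setT (EFin \o t) by exact/measurable_EFinP.
have mt' : measurable_fun setT (fun s : n.+1.-tuple T => t (tmap phi s)).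
  exact: (measurableT_comp mt (measurable_tmap mphi (n := n.+1))).
have mtE' : measurable_fun setT (fun s : n.+1.-tuple T => (t (tmap phi s))%:E).
  exact/measurable_EFinP.
apply: ereal_sup_ubound; exists (fun s => t (tmap phi s)).
  split => //.
  - move=> s /tU; congr (_ != 0); apply: eq_bigr => i _; apply: eq_bigr => j _.
    by rewrite /pull !tnth_map !phiK.
  - move=> x; apply: le_trans (tsec (phi x)); apply: lee_sum => l _.
    rewrite !int_sectionE//; try by move=> s; rewrite lee_fin.
    rewrite -(integral_tmap mphi phi_mp (g := fun s => (t (tins l (phi x) s))%:E)).
    + by under eq_integral do rewrite tmap_tins.
    + exact: measurableT_comp (measurableT_comp mtE (@measurable_tins _ _ n l))
        (measurable_pair1 (phi x)).
    + by move=> s; rewrite lee_fin.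
rewrite /tiling_size !int_tupleE//; try by move=> s; rewrite lee_fin.
by rewrite -(integral_tmap mphi phi_mp (g := EFin \o t)).
Qed.

(** The cut distance relabels [W], whereas the perturbation argument keeps [W] fixed. Substituting
    [phi] moves the relabelling to [U] and turns the test sets into their preimages. *)
Lemma cut_le_pull (U W : T -> T -> R) (phi psi : T -> T) (delta : R) :
  graphon U -> graphon W ->
  cancel phi psi -> measurable_fun setT phi -> measurable_fun setT psi ->
  (forall A : set T, measurable A -> nu (phi @^-1` A) = nu A) ->
  (cut_norm nu (fun x y => U x y - W (phi x) (phi y))%R <= delta%:E)%E ->
  cut_le nu (fun z => pull psi U z.1 z.2 - W z.1 z.2) delta.
Proof.
move=> gU gW phiK mphi mpsi phi_mp cut A B mA mB.
have bV : bmf (fun z => pull psi U z.1 z.2 - W z.1 z.2).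
  by apply: bmfB; apply: bmf_graphon => //; exact: graphon_pull.
have bAB : bmf (fun z : T * T => \1_A z.1 * \1_B z.2 : R).
  by apply: bmfM; apply: bmf_comp => //; exact: bmf_indic.
rewrite (Rint_prod_map mphi phi_mp (bmfM bAB bV)) /=.
have mpA : measurable (phi @^-1` A) by rewrite -[X in measurable X]setTI; exact: mphi.
have mpB : measurable (phi @^-1` B) by rewrite -[X in measurable X]setTI; exact: mphi.
rewrite -lee_fin; apply: le_trans cut.
apply: ereal_sup_ubound; exists (phi @^-1` A) => //; exists (phi @^-1` B) => //.
have mAB := measurableX mpA mpB.
rewrite integral_mkcond.
pose nn : probability (T * T)%type R := (nu \x nu)%E.
pose V' z := \1_A (phi z.1) * \1_B (phi z.2) * (U z.1 z.2 - W (phi z.1) (phi z.2)).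
have bphi (C : set T) (p : T * T -> T) : measurable C -> measurable_fun setT p ->
    bmf (fun z => \1_C (phi (p z)) : R).
  move=> mC mp; exact: (bmf_comp (bmf_indic mC) (measurableT_comp mphi mp)).
have bV' : bmf V'.
  apply: bmfM; last first.
    exact: bmfB (bmf_graphon gU) (bmf_graphon (graphon_pull mphi gW)).
  by apply: bmfM; [exact: bphi|exact: bphi].
have -> : (fun z => (U z.1 z.2 - W (phi z.1) (phi z.2))%:E) \_
    (phi @^-1` A `*` phi @^-1` B) = EFin \o V' :> (T * T -> \bar R).
  apply/funext => z; rewrite patchE /V' /=.
  case: ifPn => [/set_mem[zA zB]|zAB].
    by rewrite !indicE !mem_set// !mul1r.
  rewrite !indicE; case: (boolP (phi z.1 \in A)) => [zA|_]; last by rewrite !mul0r.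
  case: (boolP (phi z.2 \in B)) => [zB|_]; last by rewrite mulr0 mul0r.
  by move/negP: zAB; case; apply/mem_set; split; exact: set_mem.
rewrite [X in `|X|%E](EFin_Rint nn bV') /=.
by congr (`|_|)%:E; apply: eq_Rintegral => z _; rewrite /pull !phiK.
Qed.

End Transfer.

(* Without vertices there is no section constraint, so every constant is a tiling. *)
Lemma til_no_vertex (R : realType) d (T : measurableType d) (nu : probability T R)
  (E : rel 'I_0) (U : T -> T -> R) : til nu E U = +oo%E.
Proof.
apply: eq_infty => r; apply: (@le_trans _ _ `|r|%:E); first by rewrite lee_fin ler_norm.
apply: ereal_sup_ubound; exists (fun=> `|r|).
  split.
  - exact: measurable_cst.
  - by [].
  - by move=> x _; rewrite /Wtensor big_ord0 oner_neq0.
  - by move=> x; rewrite big_ord0.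
by rewrite /tiling_size /int_tuple /= (tup_extE _ [tuple]).
Qed.

Lemma limn_einf_ge (R : realType) (u : (\bar R)^nat) (a : \bar R) :
  (\forall n \near \oo, a <= u n)%E -> (a <= limn_einf u)%E.
Proof.
move=> [N _ aN]; rewrite limn_einf_lim; apply: lime_ge.
  by apply: ereal_nondecreasing_is_cvgn; exact: nondecreasing_einfs.
exists N => // n Nn; apply: le_ereal_inf_tmp => _ [m /= nm <-].
exact: aN (leq_trans Nn nm).
Qed.

(** * Lower semicontinuity *)

Section LowerSemicontinuity.
Context {R : realType} {d} {T : measurableType d}.
Variables (nu : probability T R) (n : nat) (E : rel 'I_n.+1).

(** For large [m] some relabelling of [Wn m] is within [delta] of [W] in cut norm. It has a tiling
    losing at most [eps], which [til_pull] carries back to [Wn m]. *)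
Lemma til_liminf_ge (Wn : nat -> T -> T -> R) (W : T -> T -> R)
  (g : n.+1.-tuple T -> R) (M : R) :
  (forall m, graphon (Wn m)) -> graphon W ->
  (fun m => cut_dist nu (Wn m) W) @ \oo --> 0%E ->
  measurable_fun setT g -> 0 <= M -> (forall t, 0 <= g t <= M) ->
  (forall x, secsum nu (fun t => g t * Wtensor E W t) x <= 1) ->
  ((\int[tpow nu n.+1]_t (g t * Wtensor E W t))%:E <=
    limn_einf (fun m => til nu E (Wn m)))%E.
Proof.
move=> gWn gW cvW mg M0 gM secW; apply/lee_subgt0Pr => eps e0.
have [delta d0 H] := bounded_density_tiling gW mg M0 gM secW e0.
apply: limn_einf_ge.
have : \forall m \near \oo, (cut_dist nu (Wn m) W < delta%:E)%E.
  exact: cvW _ (nbhs_open_ereal_lt (f := fun=> delta) d0).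
apply: filterS => m /ereal_inf_lt[_ [phi [psi [phiK psiK [mphi mpsi] phi_mp _]] <-]].
move=> /ltW cut; rewrite -EFinB.
apply: le_trans (til_pull E (Wn m) phiK mphi phi_mp).
apply: H; first exact: graphon_pull.
exact: cut_le_pull.
Qed.

(** * Truncating the density of a tiling *)

Variables (W : T -> T -> R) (t : n.+1.-tuple T -> R).
Hypothesis gW : graphon W.
Hypothesis tW : is_tiling nu E W t.

Let w := Wtensor E W.

Definition truncated_density (m : nat) x : R := Num.min (t x / w x) m%:R.

Let t0 x : 0 <= t x. Proof. by have [_ + _ _] := tW; exact. Qed.
Let mt : measurable_fun setT t. Proof. by have [] := tW. Qed.
Let w0 x : 0 <= w x. Proof. by have /andP[] := Wtensor01 E x gW. Qed.
Let mw : measurable_fun setT w. Proof. exact: (bmf_Wtensor E gW).1. Qed.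

Lemma measurable_truncated_density m : measurable_fun setT (truncated_density m).
Proof.
apply: measurable_minr => //; apply: measurable_funM => //.
(* Where [w x = 0] both sides are the junk value [0]. *)
have -> : (fun x => (w x)^-1) = (fun x => w x `^ (-1)).
  by apply/funext => x; rewrite powR_inv1.
exact: measurableT_comp (measurable_powR _) mw.
Qed.

Lemma truncated_density_bounds m x : 0 <= truncated_density m x <= m%:R.
Proof. by rewrite /truncated_density le_min ge_min lexx orbT divr_ge0//= andbT. Qed.

Let f m x := truncated_density m x * w x.

Let f0 m x : 0 <= f m x.
Proof. by have /andP[d0 _] := truncated_density_bounds m x; exact: mulr_ge0. Qed.

Let mf m : measurable_fun setT (f m).
Proof. by apply: measurable_funM => //; exact: measurable_truncated_density. Qed.

Let bf m : bmf (f m).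
Proof.
apply: bmfM; last exact: bmf_Wtensor.
split; first exact: measurable_truncated_density.
exists m%:R => x; have /andP[d0 d1] := truncated_density_bounds m x.
by rewrite ger0_norm.
Qed.

(** Where [w] vanishes the quotient is 0 by convention, and [t] vanishes too because it is supported
    where [w] is nonzero. *)
Let tw x : t x = t x / w x * w x.
Proof.
have [wx|wx] := eqVneq (w x) 0; last by rewrite divfK.
have [tx|tx] := eqVneq (t x) 0; first by rewrite tx !mul0r.
by have [_ _ /(_ x tx) + _] := tW; rewrite -/(w x) wx eqxx.
Qed.

Let ft m x : f m x <= t x.
Proof. by rewrite [leRHS]tw; apply: ler_wpM2r => //; rewrite ge_min lexx. Qed.

(** Truncation only lowers [t], so the constraint is inherited. The comparison is made in the
    extended reals because [t] may be unbounded. *)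
Lemma truncated_density_secsum m x :
  secsum nu (fun s => truncated_density m s * Wtensor E W s) x <= 1.
Proof.
rewrite -lee_fin -sum_int_sectionE; [|exact: bf|exact: f0].
have [_ _ _ /(_ x)] := tW; apply: le_trans; apply: lee_sum => l _.
have mE (h : n.+1.-tuple T -> R) : measurable_fun setT h ->
    measurable_fun setT (EFin \o h) by move=> mh; exact/measurable_EFinP.
rewrite !int_sectionE; [|exact: mE|by move=> s; rewrite lee_fin
  |exact: (mE _ (mf m))|by move=> s; rewrite lee_fin; exact: f0].
have mtins (h : n.+1.-tuple T -> R) : measurable_fun setT h ->
    measurable_fun setT (fun s => (h (tins l x s))%:E).
  move=> mh; apply/measurable_EFinP.
  exact: measurableT_comp (measurableT_comp mh (@measurable_tins _ _ n l)) (measurable_pair1 x).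
apply: ge0_le_integral => //.
- by move=> s _; rewrite lee_fin; exact: f0.
- exact: (mtins _ (mf m)).
- exact: mtins.
- by move=> s _; rewrite lee_fin; exact: ft.
Qed.

Lemma truncated_density_cvg :
  (\int[tpow nu n.+1]_x (truncated_density m x * Wtensor E W x))%:E @[m --> \oo] -->
  tiling_size nu t.
Proof.
rewrite /tiling_size int_tupleE; [|exact/measurable_EFinP|by move=> x; rewrite lee_fin].
rewrite [X in X @ _ --> _](_ : _ =
    fun m => (\int[tpow nu n.+1]_x (f m x)%:E)%E); last first.
  by apply/funext => m; rewrite EFin_Rint//; exact: bf.
have -> : (fun x => (t x)%:E) = (fun x => limn (fun m => (f m x)%:E)).
  apply/funext => x; apply/esym/lim_near_cst => //.
  (* At each point the truncation is inactive once [m] exceeds [t x / w x], so the sequence is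
     eventually constant. *)
  exists (Num.truncn (t x / w x)).+1 => // m /= mx.
  rewrite /f /truncated_density min_l -?tw//.
  by apply: le_trans (ltW (truncnS_gt _)) _; rewrite ler_nat.
apply: cvg_monotone_convergence => //.
- by move=> m; apply/measurable_EFinP; exact: mf.
- by move=> m x _; rewrite lee_fin; exact: f0.
- move=> x _ m1 m2 m12; rewrite lee_fin; apply: ler_wpM2r => //.
  by rewrite /truncated_density le_min !ge_min lexx /= ler_nat m12 orbT.
Qed.

End LowerSemicontinuity.

Theorem theorem3p7 (R : realType) (d : measure_display) (Omega : measurableType d)
  (nu : probability Omega R)
  (Hborel : std_borel R Omega) (Hatomless : atomless nu)
  (Wn : nat -> Omega -> Omega -> R) (W : Omega -> Omega -> R)
  (HWn : forall n, graphon (Wn n)) (HW : graphon W)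
  (Hconv : (fun n => cut_dist nu (Wn n) W) @ \oo --> 0%E)
  (k : nat) (E : rel 'I_k) (HF : simple_graph E) :
  (til nu E W <= limn_einf (fun n => til nu E (Wn n)))%E.
Proof.
(* With no vertices the tiling numbers of all [Wn m] are infinite. Otherwise a coordinate can be
   singled out in ['I_n.+1]. *)
case: k E HF => [|n] E _.
  rewrite (_ : (fun m => til nu E (Wn m)) = cst +oo%E); last first.
    by apply/funext => m; rewrite til_no_vertex.
  by rewrite (cvg_limn_einf_sup (cvg_cst _)).1 leey.
apply: ub_ereal_sup => _ [t tW <-].
have cv := truncated_density_cvg HW tW.
(* The size of [t] is the limit of the truncated sizes, so it suffices to bound each of these, whose
   density is at most [m]. *)
rewrite -(cvg_lim _ cv)//; apply: lime_le; first exact: cvgP cv.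
apply: nearW => m; apply: (til_liminf_ge HWn HW Hconv (M := m%:R)) => //.
- exact: measurable_truncated_density HW tW m.
- exact: truncated_density_bounds HW tW m.
- exact: truncated_density_secsum.
Qed.
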